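(* Let $\mathcal{H}$ be a complex Hilbert space and let $A\in\mathcal{B}(\mathcal{H})$. Then for all $\alpha\in[0,1]$, $$ w^2(A)\leq\frac{1}{4}\left\||A|^{4\alpha}+|A^*|^{4(1-\alpha)}\right\|+\frac{1}{2}\,w\left(|A^*|^{2(1-\alpha)}|A|^{2\alpha}\right). $$
   Context: $\mathcal{B}(\mathcal{H})$ denotes the $C^*$-algebra of bounded linear operators on the complex Hilbert space $\mathcal{H}$, with operator norm $\|\cdot\|$. For $T\in\mathcal{B}(\mathcal{H})$, $|T|=(T^*T)^{1/2}$, and powers $|T|^s$ ($s\ge 0$) are taken by the continuous functional calculus, with $|T|^0=I$. The numerical radius is $w(T)=\sup\{|\langle Tx,x\rangle|: x\in\mathcal{H},\ \|x\|=1\}$, and $w^2(T)=(w(T))^2$. *)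

(* Defs.v *)
From HB Require Import structures.
From mathcomp Require Import all_boot all_order all_algebra.
From mathcomp Require Import complex.
From mathcomp Require Import all_classical all_reals all_analysis.

Set Implicit Arguments.
Unset Strict Implicit.
Unset Printing Implicit Defensive.

Import Order.TTheory GRing.Theory Num.Theory.
Import numFieldNormedType.Exports.

Local Open Scope classical_set_scope.
Local Open Scope ring_scope.
Local Open Scope complex_scope.

(* A complex Hilbert space is a complete normed module H over R[i] together
   with an inner product dot : {dot H for Num.conj} (linear in its first
   argument) satisfying `|x| ^+ 2 = dot x x.  Operators are plain functions
   H -> H, subject to the predicate bounded_op where it matters. *)

Section Operators.
Context {R : realType} {H : completeNormedModType R[i]}.
Implicit Types S T : H -> H.

Definition bounded_op T : Prop := linear T /\ continuous T.

(* Norms of vectors live in R[i]; complex.Re recovers the real number. *)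
Definition opnorm T : R :=
  sup [set complex.Re `|T x| | x in [set x : H | `|x| <= 1]].

Definition op_invertible T : Prop :=
  exists2 S, bounded_op S & cancel T S /\ cancel S T.

Definition spectrum T : set R[i] :=
  [set z | ~ op_invertible (fun x => T x - z *: x)].

Definition poly_op (p : {poly R}) T : H -> H :=
  fun x => \sum_(i < size p) (p`_i)%:C *: iter i T x.

(* Continuous functional calculus of a self-adjoint T, whose spectrum is real,
   at a real function f continuous on the spectrum: f(T) is the norm limit of
   p_n(T) for polynomials p_n converging to f uniformly on the spectrum. *)
Definition is_cfc (f : R -> R) T S : Prop :=
  bounded_op S /\
  forall p : nat -> {poly R},
    {uniform [set t : R | spectrum T t%:C],
      (fun n t => (p n).[t]) @ \oo --> f} ->
    opnorm (poly_op (p n) T \- S) @[n --> \oo] --> 0.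

(* Such an S exists and is unique for T, f as above; otherwise the value is
   irrelevant. *)
Definition cfc (f : R -> R) T : H -> H := xget (fun=> 0) [set S | is_cfc f T S].

(* T ^ s for a positive operator T and s >= 0.  Since 0 `^ 0 = 1, this gives
   T ^ 0 = id. *)
Definition op_pow T (s : R) : H -> H := cfc (fun t => t `^ s) T.

Section InnerProduct.
Variable dot : {dot H for Num.conj}.

(* The adjoint exists and is unique when T is bounded, by the Riesz
   representation theorem. *)
Definition adjoint T : H -> H :=
  xget (fun=> 0)
    [set S | bounded_op S /\ forall x y, dot (T x) y = dot x (S y)].

Definition op_abs T : H -> H := op_pow (adjoint T \o T) 2^-1.

Definition numerical_radius T : R :=
  sup [set complex.Re `|dot (T x) x| | x in [set x : H | `|x| = 1]].

End InnerProduct.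
End Operators.

(* Main.v *)
Require Import Defs.
From HB Require Import structures.
From mathcomp Require Import all_boot all_order all_algebra.
From mathcomp Require Import complex.
From mathcomp Require Import all_classical all_reals all_analysis.
From mathcomp Require Import ring lra.

(** Let [P = A* A] and [Q = A A*], so that [|A| = P^(1/2)] and [|A*| = Q^(1/2)].
    The mixed Schwarz inequality bounds [|<A x, x>|^2] by [<a, x> <b, x>] with
    [a = P^alpha x] and [b = Q^(1 - alpha) x]; for a unit vector [x], Buzano's
    inequality bounds this by [(|a| |b| + |<a, b>|) / 2], and
    [2 |a| |b| <= |a|^2 + |b|^2 = <(P^(2 alpha) + Q^(2 (1 - alpha))) x, x>].

    The functional calculus of a positive operator [T] rests on the bound
    [|p(T)| <= sup |p|] over the spectrum. With [m = |p(T)|], the operator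
    [p(T)^2 - m^2] is not bounded below; factoring [p^2 - m^2] over the complex
    numbers, some [T - z] with [p(z)^2 = m^2] is not bounded below either, and
    such a [z] is real and belongs to the spectrum. *)

Set Implicit Arguments.
Unset Strict Implicit.
Unset Printing Implicit Defensive.

Import Order.TTheory GRing.Theory Num.Theory.
Import numFieldNormedType.Exports.

Local Open Scope ring_scope.

(** * Polynomial approximation of powers *)

(** [cfc] selects an operator that must work for all polynomial sequences converging on the
    spectrum, so [op_pow] says nothing until existence and uniqueness are known; existence calls for
    polynomials close to [t ^ s]. Approximation is done on whole intervals [0, M], so that a larger
    M makes one polynomial serve two purposes: for the spectra of P and Q together, which gives A
    f(P) = f(Q) A, and for the spectrum of f(T) together with the values of f, which gives (g o
    f)(T) = g(f(T)). The second rule turns powers of |A| into powers of P. The first carries the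
    mixed Schwarz inequality, where it moves A across a function of P. The obstacle there is that
    P^alpha may fail to be invertible; P^alpha + e is used instead, and e tends to 0 at the end.
    This is why 1 / (t^alpha + e) is approximated along with the powers. The adjoint and the inverse
    of T - t for t outside [0, M] both come from one variational argument, applied to a real
    functional. *)

Section Approximation.
Context {R : realType}.
Implicit Types (f g : R -> R) (p q : {poly R}) (M B a c d e s x y : R).

(* Bernstein polynomials (with nodes indexed by nat), by the recursion on a
   binomial random walk: the second moment is then a one-line induction. *)
Fixpoint bernstein (n : nat) (g : nat -> R) : {poly R} :=
  if n is m.+1 then
    'X * bernstein m (fun k => g k.+1) + (1 - 'X) * bernstein m g
  else (g 0%N)%:P.

(** Variance plus squared bias of a binomial variable of mean [n%:R * x]: the value at [x] is an
    expectation over the walk. The induction is over all [a], because a first step up replaces [a]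
    by [a - 1]. *)
Lemma bernstein_moment2 n a x : (bernstein n (fun k => (k%:R - a) ^+ 2)).[x] =
  n%:R * (x * (1 - x)) + (n%:R * x - a) ^+ 2.
Proof.
elim: n a => [|n IH] a /=; first by rewrite hornerC; ring.
rewrite !(hornerD, hornerM, hornerN, hornerX, hornerC) IH.
have -> : bernstein n (fun k => (k.+1%:R - a) ^+ 2) =
          bernstein n (fun k => (k%:R - (a - 1)) ^+ 2).
  by congr bernstein; apply/funext => k; rewrite -natr1; congr (_ ^+ 2); ring.
by rewrite IH -natr1; ring.
Qed.

(** On [0, 1] the two branches of the recursion have nonnegative weights of sum 1, so a bound at the
    nodes survives averaging. The error is affine in [h] so that the second moment can be
    inserted. *)
Lemma bernstein_approx n (g h : nat -> R) c d e x : 0 <= x <= 1 ->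
  (forall k, (k <= n)%N -> `|g k - c| <= e + d * h k) ->
  `|(bernstein n g).[x] - c| <= e + d * (bernstein n h).[x].
Proof.
move=> /andP[x0 x1]; elim: n g h => [|n IH] g h gh /=.
  by rewrite !hornerE; exact: gh.
have IH1 := IH (fun k => g k.+1) (fun k => h k.+1) (fun k kn => gh k.+1 kn).
have IH0 := IH g h (fun k kn => gh k (leqW kn)).
rewrite !(hornerD, hornerM, hornerN, hornerX, hornerC).
set u := (bernstein n (fun k => g k.+1)).[x] in IH1 *.
set v := (bernstein n g).[x] in IH0 *.
have -> : x * u + (1 - x) * v - c = x * (u - c) + (1 - x) * (v - c) by ring.
apply: le_trans (ler_normD _ _) _.
rewrite !normrM (ger0_norm x0) (@ger0_norm _ (1 - x)) ?subr_ge0//.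
apply: le_trans (lerD (ler_wpM2l x0 IH1) (ler_wpM2l _ IH0)) _.
  by rewrite subr_ge0.
rewrite le_eqVlt; apply/orP; left; apply/eqP; ring.
Qed.

Definition unif_continuous_itv M f := forall e : R, 0 < e ->
  exists2 d : R, 0 < d & forall x y : R, 0 <= x <= M -> 0 <= y <= M ->
    `|x - y| < d -> `|f x - f y| <= e.

Definition poly_approx M f := forall e : R, 0 < e ->
  exists p, forall t, 0 <= t <= M -> `|p.[t] - f t| <= e.

(** The interval is cut into [N] pieces shorter than the modulus [d] for tolerance 1; each piece
    adds at most 1 to the bound. *)
Lemma unif_continuous_itv_bounded M f : 0 < M ->
  unif_continuous_itv M f -> exists2 B : R, 0 < B & forall x, 0 <= x <= M -> `|f x| <= B.
Proof.
move=> M0 /(_ 1 ltr01)[d d0 fd].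
pose N := (Num.trunc (M / d)).+1.
exists (`|f 0| + N%:R).
  by rewrite ltr_wpDl// ltr0n.
have Md : M / N%:R < d.
  rewrite ltr_pdivrMr ?ltr0n// mulrC -ltr_pdivrMr//.
  by rewrite truncnS_gt.
suff H k : (k <= N)%N -> forall x, 0 <= x <= M * k%:R / N%:R -> `|f x| <= `|f 0| + k%:R.
  move=> x xM; apply: (H N) => //.
  by rewrite mulfK// pnatr_eq0.
elim: k => [|k IH] kN x.
  rewrite mulr0 mul0r addr0 -eq_le => /eqP <-//.
move=> /andP[x0 xk].
have NR0 : 0 < N%:R :> R by rewrite ltr0n.
have xM : x <= M.
  apply: le_trans xk _; rewrite ler_pdivrMr// ler_wpM2l ?(ltW M0)//.
  by rewrite ler_nat.
have [xl|xg] := leP x (M * k%:R / N%:R).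
  apply: le_trans (IH (ltnW kN) x _) _; first by rewrite x0.
  by rewrite lerD2l ler_nat.
set y := M * k%:R / N%:R in xg IH *.
have y0 : 0 <= y by rewrite /y !mulr_ge0 ?invr_ge0 ?ler0n// ltW.
have hy : `|f y| <= `|f 0| + k%:R by apply: IH; rewrite ?(ltnW kN) ?y0/=.
have hxy : `|f x - f y| <= 1.
  apply: fd; rewrite ?x0 ?y0 ?xM ?(le_trans (ltW xg))//.
  rewrite gtr0_norm ?subr_gt0//; apply: le_lt_trans Md.
  rewrite lerBlDr; apply: le_trans xk _.
  by rewrite -natr1 mulrDr mulr1 mulrDl /y addrC.
rewrite -natr1 addrA -[f x](subrK (f y)) [leRHS]addrC.
by apply: le_trans (ler_normD _ _) _; apply: lerD.
Qed.

Lemma weierstrass M f : 0 < M -> unif_continuous_itv M f -> poly_approx M f.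
Proof.
move=> M0 fu e e0.
have [B B0 fB] := unif_continuous_itv_bounded M0 fu.
have e20 : 0 < e / 2 by rewrite divr_gt0.
have [d d0 fd] := fu _ e20.
(* Fitted to the far case: [|x - y| >= d] makes [C * (x - y) ^+ 2] at least [2 * B], which no
   oscillation of [f] exceeds. *)
pose C := 2 * B / d ^+ 2.
have C0 : 0 < C by rewrite divr_gt0 ?mulr_gt0 ?exprn_gt0.
have fC x y : 0 <= x <= M -> 0 <= y <= M -> `|f x - f y| <= e / 2 + C * (x - y) ^+ 2.
  move=> xM yM; have [xy|xy] := ltP `|x - y| d.
    apply: le_trans (fd _ _ xM yM xy) _.
    by rewrite lerDl mulr_ge0 ?(ltW C0) ?sqr_ge0.
  apply: (@le_trans _ _ (2 * B)).
    apply: le_trans (ler_normB _ _) _.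
    by rewrite mulr_natl mulr2n lerD ?fB.
  apply: (@le_trans _ _ (C * d ^+ 2)); first by rewrite /C divfK// sqrf_eq0 gt_eqF.
  apply: (@le_trans _ _ (C * (x - y) ^+ 2)); last by rewrite lerDr ltW.
  rewrite ler_wpM2l ?(ltW C0)// -[leRHS]real_normK ?num_real//.
  by rewrite ler_pXn2r ?nnegrE ?normr_ge0 ?(ltW d0).
(* The random node [M * K / n] has variance [M ^ 2 * x * (1 - x) / n]; this [n] brings [C] times it
   below [e / 2]. *)
pose n := (Num.trunc (C * M ^+ 2 / (e / 2))).+1.
have n0 : 0 < n%:R :> R by rewrite ltr0n.
have nC : C * M ^+ 2 / n%:R <= e / 2.
  rewrite ler_pdivrMr// [leRHS]mulrC -ler_pdivrMr// ltW//.
  exact: truncnS_gt.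
exists (bernstein n (fun k => f (M * k%:R / n%:R)) \Po (M^-1 *: 'X)) => t /andP[t0 tM].
rewrite horner_comp hornerZ hornerX.
set x := M^-1 * t.
have x01 : 0 <= x <= 1.
  by rewrite /x mulr_ge0 ?invr_ge0 ?(ltW M0)//= mulrC ler_pdivrMr// mul1r.
have -> : t = M * x by rewrite /x mulrA mulfV ?mul1r// gt_eqF.
apply: (@le_trans _ _ (e / 2 + (C * M ^+ 2 / n%:R ^+ 2) *
   (bernstein n (fun k => (k%:R - n%:R * x) ^+ 2)).[x])).
  apply: bernstein_approx => // k kn.
  have <- : C * (M * k%:R / n%:R - M * x) ^+ 2 =
      C * M ^+ 2 / n%:R ^+ 2 * (k%:R - n%:R * x) ^+ 2.
    by field; rewrite gt_eqF.
  apply: fC.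
    rewrite !mulr_ge0 ?invr_ge0 ?ler0n ?(ltW M0)//=.
    by rewrite ler_pdivrMr// ler_wpM2l ?(ltW M0)// ler_nat.
  case/andP: x01 => x0 x1.
  by rewrite mulr_ge0 ?(ltW M0)//= -[leRHS]mulr1 ler_wpM2l ?(ltW M0).
rewrite bernstein_moment2 subrr expr0n addr0 mulrA.
have -> : C * M ^+ 2 / n%:R ^+ 2 * n%:R = C * M ^+ 2 / n%:R by field; rewrite gt_eqF.
rewrite -lerBrDl; have -> : e - e / 2 = e / 2 by field.
apply: le_trans nC; rewrite -[leRHS]mulr1 ler_wpM2l//.
  by rewrite divr_ge0 ?ler0n// mulr_ge0 ?sqr_ge0 ?(ltW C0).
case/andP: x01 => x0 x1; nra.
Qed.

Lemma poly_approx_bounded M f : poly_approx M f ->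
  exists2 B : R, 0 < B & forall x, 0 <= x <= M -> `|f x| <= B.
Proof.
move=> /(_ 1 ltr01)[p pf]; have [B pB] := poly_itv_bound p 0 M.
exists (`|B| + 1); first by rewrite ltr_wpDl.
move=> x xM; rewrite -[f x](subKr (p.[x])) (le_trans (ler_normB _ _))//.
by apply: lerD (pf _ xM); apply: le_trans (pB _ xM) (ler_norm _).
Qed.

(** The error is [(p - f) q + f (q - g)]: the bound on [f] fixes the tolerance for [q], and then a
    bound on [q] fixes the tolerance for [p]. *)
Lemma poly_approxM M f g : poly_approx M f -> poly_approx M g ->
  poly_approx M (fun t => f t * g t).
Proof.
move=> fW gW e e0.
have [B B0 fB] := poly_approx_bounded fW.
have [q qg] := gW (e / (2 * B)) (divr_gt0 e0 (mulr_gt0 (ltr0n _ 2) B0)).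
have [D qD] := poly_itv_bound q 0 M.
have D0 : 0 < `|D| + 1 by rewrite ltr_wpDl.
have [p pf] := fW (e / (2 * (`|D| + 1))) (divr_gt0 e0 (mulr_gt0 (ltr0n _ 2) D0)).
exists (p * q) => t tM; rewrite hornerM.
have -> : p.[t] * q.[t] - f t * g t = (p.[t] - f t) * q.[t] + f t * (q.[t] - g t) by ring.
apply: le_trans (ler_normD _ _) _; rewrite !normrM.
have -> : e = e / (2 * (`|D| + 1)) * (`|D| + 1) + B * (e / (2 * B)).
  by field; rewrite !gt_eqF.
apply: lerD; apply: ler_pM => //; [exact: pf| |exact: fB|exact: qg].
apply: le_trans (qD _ tM) _; apply: le_trans (ler_norm _) _.
by rewrite lerDl.
Qed.

Lemma poly_approx_exp M f n : poly_approx M f -> poly_approx M (fun t => f t ^+ n).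
Proof.
move=> fW; elim: n => [|n IH].
  by move=> e e0; exists 1 => t _; rewrite hornerE expr0 subrr normr0 ltW.
move=> e e0; have [p pf] := poly_approxM fW IH e0.
by exists p => t /pf; rewrite exprS.
Qed.

(** If [0 <= u <= 1] and [s <= 1] then [u <= u ^ s]; take [u = x / (x + y)] and [u = y / (x + y)],
    and add. *)
Lemma powR_subadd s x y : 0 < s <= 1 -> 0 <= x -> 0 <= y ->
  (x + y) `^ s <= x `^ s + y `^ s.
Proof.
move=> /andP[s0 s1] x0 y0.
have [xy0|xy0] := eqVneq (x + y) 0.
  by rewrite xy0 powR0 ?gt_eqF// addr_ge0 ?powR_ge0.
have xyp : 0 < x + y by rewrite lt_def xy0 addr_ge0.
have H z : 0 <= z -> z <= x + y -> z / (x + y) * (x + y) `^ s <= z `^ s.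
  move=> z0 zxy.
  have -> : z `^ s = (z / (x + y)) `^ s * (x + y) `^ s.
    rewrite -powRM; [|by rewrite divr_ge0// ltW|exact: ltW].
    by rewrite divfK.
  rewrite ler_wpM2r ?powR_ge0//.
  have [->|zn0] := eqVneq z 0; first by rewrite mul0r powR_ge0.
  have w0 : 0 < z / (x + y) by rewrite divr_gt0// lt_def zn0.
  rewrite -[leLHS]powRr1 ?(ltW w0)//.
  rewrite ger_powR// w0/=.
  by rewrite ler_pdivrMr// mul1r.
have := lerD (H x x0 _) (H y y0 _).
rewrite lerDl lerDr => /(_ y0 x0).
by rewrite -mulrDl -mulrDl divff// mul1r.
Qed.

(** Subadditivity gives the Hölder estimate [|x ^ s - y ^ s| <= |x - y| ^ s], hence the modulus
    [e ^ (1 / s)]. *)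
Lemma powR_unif_continuous_itv M s : 0 < s <= 1 ->
  unif_continuous_itv M (fun t => t `^ s).
Proof.
move=> s01 e e0; have s0 : 0 < s by case/andP: s01.
exists (e `^ (s^-1)); first by rewrite powR_gt0.
have H x y : 0 <= y -> y <= x -> `|x - y| < e `^ s^-1 -> `|x `^ s - y `^ s| <= e.
  move=> y0 yx xye.
  have x0 := le_trans y0 yx.
  rewrite ger0_norm ?subr_ge0; last by rewrite ge0_ler_powR// ltW.
  have := powR_subadd s01 y0 (_ : 0 <= x - y); rewrite subr_ge0 => /(_ yx).
  rewrite [y + _]addrC subrK -lerBlDl => /le_trans; apply.
  have -> : e = (e `^ s^-1) `^ s by rewrite -powRrM mulVf ?gt_eqF// powRr1// ltW.
  rewrite ge0_ler_powR ?(ltW s0) ?nnegrE ?subr_ge0 ?powR_ge0//.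
  by apply: ltW; apply: le_lt_trans (ler_norm _) xye.
move=> x y /andP[x0 _] /andP[y0 _] xy.
have [yx|xy'] := leP y x; first exact: H.
by rewrite distrC; apply: H => //; rewrite ?(ltW xy')// distrC.
Qed.

(** The Hölder estimate stops at exponent 1; in general [t ^ s] is the [n]-th power of [t ^ (s / n)]
    with [n > s]. Exponent 0 gives the constant 1, at [t = 0] included. *)
Lemma poly_approx_powR M s : 0 < M -> 0 <= s -> poly_approx M (fun t => t `^ s).
Proof.
move=> M0; rewrite le_eqVlt => /predU1P[<-|s0].
  by move=> e e0; exists 1 => t _; rewrite hornerE powRr0 subrr normr0 ltW.
pose n := (Num.trunc s).+1.
have n0 : 0 < n%:R :> R by rewrite ltr0n.
have sn : 0 < s / n%:R <= 1.
  by rewrite divr_gt0//= ler_pdivrMr// mul1r ltW// truncnS_gt.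
have := poly_approx_exp n (weierstrass M0 (@powR_unif_continuous_itv M _ sn)).
move=> H e /H[p pf]; exists p => t /[dup] tM /pf.
by rewrite -powR_mulrn ?powR_ge0// -powRrM divfK ?gt_eqF.
Qed.

Lemma poly_approx_inv_powR M s e : 0 < M -> 0 <= s <= 1 -> 0 < e ->
  poly_approx M (fun t => (t `^ s + e)^-1).
Proof.
move=> M0 /andP[+ s1] e0; rewrite le_eqVlt => /predU1P[<-|s0].
  by move=> d d0; exists (1 + e)^-1%:P => t _; rewrite hornerE powRr0 subrr normr0 ltW.
apply: weierstrass => // d d0.
have s01 : 0 < s <= 1 by rewrite s0.
(* Both denominators are at least [e], so inversion multiplies errors by at most [1 / e ^ 2]; the
   tolerance is [d * e ^ 2] accordingly. *)
have [r r0 H] := @powR_unif_continuous_itv M _ s01 _ (mulr_gt0 d0 (exprn_gt0 2 e0)).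
exists r => // x y xM yM xy.
have := H _ _ xM yM xy.
have := powR_ge0 x s; have := powR_ge0 y s.
set a := x `^ s; set b := y `^ s => b0 a0 ab.
have ae : 0 < a + e by rewrite ltr_wpDl.
have be : 0 < b + e by rewrite ltr_wpDl.
have -> : (a + e)^-1 - (b + e)^-1 = (b - a) / ((a + e) * (b + e)).
  by field; rewrite !gt_eqF.
rewrite normrM distrC (@gtr0_norm _ (_^-1)) ?invr_gt0 ?mulr_gt0//.
rewrite ler_pdivrMr ?mulr_gt0//; apply: le_trans ab _.
rewrite ler_wpM2l ?(ltW d0)//; nra.
Qed.

End Approximation.

(** * Real parts of the norm and of the inner product *)

Section HilbertSpace.
Context {R : realType} {H : completeNormedModType R[i]}.
Variable dot : {dot H for Num.conj}.
Hypothesis dot_norm : forall x : H, `|x| ^+ 2 = dot x x.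
Local Open Scope classical_set_scope.
Local Open Scope ring_scope.
Local Open Scope complex_scope.
Implicit Types (x y z : H) (S T U : H -> H) (r s t c e : R) (p q : {poly R}).

(* All estimates are made on these real-valued versions of the [R[i]]-valued norm
   and inner product. *)
Definition rnorm x : R := complex.Re `|x|.
Definition rdot x y : R := complex.Re (dot x y).

Lemma rnormE x : `|x| = (rnorm x)%:C.
Proof. by rewrite /rnorm RRe_real// normr_real. Qed.

Lemma rnorm_ge0 x : 0 <= rnorm x.
Proof. by rewrite -ler0c -rnormE. Qed.

Lemma rnorm_eq0 x : rnorm x = 0 -> x = 0.
Proof. by move=> x0; apply/normr0_eq0; rewrite rnormE x0. Qed.

Lemma rnorm0 : rnorm 0 = 0.
Proof. by rewrite /rnorm normr0. Qed.

Lemma rnormN x : rnorm (- x) = rnorm x.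
Proof. by rewrite /rnorm normrN. Qed.

Lemma rnormB x y : rnorm (x - y) = rnorm (y - x).
Proof. by rewrite -rnormN opprB. Qed.

Lemma rnormD x y : rnorm (x + y) <= rnorm x + rnorm y.
Proof. by rewrite -lecR rmorphD/= -!rnormE ler_normD. Qed.

Lemma rnorm_triangle z x y : rnorm (x - y) <= rnorm (x - z) + rnorm (z - y).
Proof. by apply: le_trans (rnormD _ _); rewrite addrA subrK. Qed.

Lemma rnormZ (a : R[i]) x : rnorm (a *: x) = complex.Re `|a| * rnorm x.
Proof.
apply: (@complexI R); rewrite -rnormE normrZ rmorphM.
by congr (_ * _); rewrite ?rnormE// RRe_real// normr_real.
Qed.

Lemma rnormZr r x : rnorm (r%:C *: x) = `|r| * rnorm x.
Proof.
by rewrite rnormZ normc_def/= expr0n addr0 sqrtr_sqr.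
Qed.

Lemma ReM_real r (a : R[i]) : complex.Re (r%:C * a) = r * complex.Re a.
Proof. by case: a => a b /=; rewrite mul0r subr0. Qed.

Lemma Re_conjC (a : R[i]) : complex.Re (Num.conj a) = complex.Re a.
Proof. by case: a. Qed.

Lemma Im_conjC (a : R[i]) : complex.Im (Num.conj a) = - complex.Im a.
Proof. by case: a. Qed.

Lemma dotC x y : dot x y = Num.conj (dot y x).
Proof. by rewrite hermC expr0 mul1r. Qed.

Lemma dotDl x y z : dot (x + y) z = dot x z + dot y z.
Proof. exact: linearDl. Qed.
Lemma dotDr x y z : dot z (x + y) = dot z x + dot z y.
Proof. exact: linearDr. Qed.
Lemma dotZl (a : R[i]) x y : dot (a *: x) y = a * dot x y.
Proof. exact: linearZl_LR. Qed.
Lemma dotZr (a : R[i]) x y : dot x (a *: y) = Num.conj a * dot x y.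
Proof. exact: linearZr_LR. Qed.

Lemma dotNl x y : dot (- x) y = - dot x y.
Proof. exact: linearNl. Qed.
Lemma dotNr x y : dot x (- y) = - dot x y.
Proof. exact: linearNr. Qed.

Lemma rdotC x y : rdot x y = rdot y x.
Proof. by rewrite /rdot dotC Re_conjC. Qed.
Lemma rdotDl x y z : rdot (x + y) z = rdot x z + rdot y z.
Proof. by rewrite /rdot dotDl raddfD. Qed.
Lemma rdotDr x y z : rdot z (x + y) = rdot z x + rdot z y.
Proof. by rewrite /rdot dotDr raddfD. Qed.
Lemma rdotNl x z : rdot (- x) z = - rdot x z.
Proof. by rewrite /rdot dotNl raddfN. Qed.
Lemma rdotNr x z : rdot z (- x) = - rdot z x.
Proof. by rewrite /rdot dotNr raddfN. Qed.
Lemma rdotBl x y z : rdot (x - y) z = rdot x z - rdot y z.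
Proof. by rewrite rdotDl rdotNl. Qed.
Lemma rdotZl r x y : rdot (r%:C *: x) y = r * rdot x y.
Proof. by rewrite /rdot dotZl ReM_real. Qed.
Lemma rdotZr r x y : rdot x (r%:C *: y) = r * rdot x y.
Proof. by rewrite rdotC rdotZl rdotC. Qed.

Definition rdotE := (rdotDl, rdotDr, rdotNl, rdotNr, rdotZl, rdotZr).

Lemma rdotxx x : rdot x x = rnorm x ^+ 2.
Proof. by rewrite /rdot -dot_norm rnormE -rmorphXn. Qed.

Lemma dot_real x : dot x x = (rnorm x ^+ 2)%:C.
Proof. by rewrite -dot_norm rnormE rmorphXn. Qed.

Lemma sqr_le_of_quadratic_ge0 (a b c : R) : 0 <= a ->
  (forall t, 0 <= a * t ^+ 2 + 2 * b * t + c) -> b ^+ 2 <= a * c.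
Proof.
rewrite le_eqVlt => /predU1P[<- h|a0 h].
  rewrite mul0r; have [->|b0] := eqVneq b 0; first by rewrite expr0n.
  (* At this point the affine function [2 * b * t + c] takes the value -1. *)
  have := h (- (c + 1) / (2 * b)).
  have -> : 0 * (- (c + 1) / (2 * b)) ^+ 2 + 2 * b * (- (c + 1) / (2 * b)) + c = -1.
    by field.
  by rewrite ler0N1.
have := h (- b / a).
have -> : a * (- b / a) ^+ 2 + 2 * b * (- b / a) + c = (a * c - b ^+ 2) / a.
  by field; rewrite gt_eqF.
by rewrite pmulr_lge0 ?invr_gt0// subr_ge0.
Qed.

Lemma rdot_le x y : rdot x y <= rnorm x * rnorm y.
Proof.
have := @sqr_le_of_quadratic_ge0 (rnorm x ^+ 2) (rdot x y) (rnorm y ^+ 2) (sqr_ge0 _).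
rewrite -exprMn => h; apply: le_trans (ler_norm _) _.
rewrite -ler_sqr ?nnegrE ?mulr_ge0 ?rnorm_ge0// real_normK ?num_real//.
apply: h => t.
have : 0 <= rdot (t%:C *: x + y) (t%:C *: x + y) by rewrite rdotxx sqr_ge0.
rewrite !rdotE !rdotxx [rdot y x]rdotC; lra.
Qed.

Lemma dot_le x y : complex.Re `|dot x y| <= rnorm x * rnorm y.
Proof.
have [->|d0] := eqVneq (dot x y) 0.
  by rewrite normr0 mulr_ge0 ?rnorm_ge0.
(* Rotating [x] by this phase makes the inner product real and equal to its modulus, which reduces
   the claim to the real inequality. *)
pose u := Num.conj (dot x y) / `|dot x y|.
have u1 : `|u| = 1.
  by rewrite normrM normfV normr_id norm_conjC divff// normr_eq0.
have := rdot_le (u *: x) y.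
rewrite rnormZ u1 mul1r /rdot dotZl.
rewrite /u mulrAC [Num.conj _ * _]mulrC -normCK expr2 mulfK//.
by rewrite normr_eq0.
Qed.

Lemma Re_le_norm (a : R[i]) : complex.Re a <= complex.Re `|a|.
Proof.
apply: le_trans (ler_norm _) _; rewrite -lecR.
by rewrite [X in _ <= X]RRe_real ?normr_real// normc_ge_Re.
Qed.

Lemma Re_norm_ge0 (a : R[i]) : 0 <= complex.Re `|a|.
Proof. by rewrite -ler0c RRe_real ?normr_real. Qed.

(** * Linear and bounded operators *)

Lemma linear_opD T : linear T -> {morph T : x y / x + y}.
Proof. by move=> lT x y; rewrite -[x]scale1r lT !scale1r. Qed.

Lemma linear_op0 T : linear T -> T 0 = 0.
Proof.
by move=> /linear_opD/(_ 0 0)/eqP; rewrite addr0 -subr_eq0 opprD addNKr oppr_eq0 => /eqP.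
Qed.

Lemma linear_opZ T : linear T -> forall (a : R[i]) x, T (a *: x) = a *: T x.
Proof. by move=> lT a x; rewrite -[a *: x]addr0 lT (linear_op0 lT) addr0. Qed.

Lemma linear_opN T : linear T -> {morph T : x / - x}.
Proof. by move=> lT x; rewrite -scaleN1r linear_opZ// scaleN1r. Qed.

Lemma linear_opB T : linear T -> {morph T : x y / x - y}.
Proof. by move=> lT x y; rewrite linear_opD// linear_opN. Qed.

Lemma bounded_opP T : bounded_op T <->
  linear T /\ exists2 c, 0 <= c & forall x, rnorm (T x) <= c * rnorm x.
Proof.
split=> -[lT]; pose f : {linear H -> H} := HB.pack T (GRing.isLinear.Build _ _ _ _ T lT).
  move=> cT; split=> //.
  have /(linear_boundedP f) : bounded_near f (nbhs 0) by apply/linear_bounded_continuous.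
  move=> /pinfty_ex_gt0[M M0 fM]; exists (complex.Re M).
    by move: M0; rewrite ltcE => /andP[_ /ltW].
  move=> x; rewrite -lecR rmorphM/= -!rnormE RRe_real; last exact: gtr0_real.
  exact: fM.
move=> [c c0 Tc]; split=> //.
suff: bounded_near f (nbhs 0) by move/bounded_linear_continuous.
apply/linear_boundedP; near=> M => x.
apply: (@le_trans _ _ (c%:C * `|x|)).
  by rewrite !rnormE -rmorphM lecR; exact: Tc.
rewrite ler_wpM2r//; near: M; apply: nbhs_pinfty_ge.
by apply/complex_realP; exists c.
Unshelve. all: by end_near. Qed.

Lemma bounded_opD S T : bounded_op S -> bounded_op T -> bounded_op (S \+ T).
Proof.
move=> /bounded_opP[lS [c1 c10 h1]] /bounded_opP[lT [c2 c20 h2]].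
apply/bounded_opP; split.
  by move=> a x y /=; rewrite lS lT scalerDr addrACA.
exists (c1 + c2); first exact: addr_ge0.
by move=> x; apply: le_trans (rnormD _ _) _; rewrite mulrDl lerD.
Qed.

Lemma bounded_op_comp S T : bounded_op S -> bounded_op T -> bounded_op (S \o T).
Proof.
move=> /bounded_opP[lS [c1 c10 h1]] /bounded_opP[lT [c2 c20 h2]].
apply/bounded_opP; split; first by move=> a x y /=; rewrite lT lS.
exists (c1 * c2); first exact: mulr_ge0.
by move=> x /=; apply: le_trans (h1 _) _; rewrite -mulrA ler_wpM2l.
Qed.

Lemma bounded_opZ (a : R[i]) : bounded_op (fun x => a *: x).
Proof.
apply/bounded_opP; split.
  by move=> b x y; rewrite scalerDr !scalerA mulrC.
by exists (complex.Re `|a|); [exact: Re_norm_ge0|move=> x; rewrite rnormZ].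
Qed.

Lemma bounded_opN T : bounded_op T -> bounded_op (fun x => - T x).
Proof.
move=> /(bounded_op_comp (bounded_opZ (-1))).
by congr bounded_op; apply/funext => x /=; rewrite scaleN1r.
Qed.

Lemma bounded_opB S T : bounded_op S -> bounded_op T -> bounded_op (S \- T).
Proof. by move=> bS bT; exact: bounded_opD bS (bounded_opN bT). Qed.

Lemma complete_seq (u : nat -> H) :
  (forall e, 0 < e -> exists N, forall m n, (N <= m)%N -> (N <= n)%N -> rnorm (u m - u n) <= e) ->
  exists l, forall e, 0 < e -> exists N, forall n, (N <= n)%N -> rnorm (l - u n) <= e.
Proof.
move=> uC.
have : cauchy (u @ \oo).
  apply: cauchy_exP => e; rewrite ltcE => /andP[/eqP eI e0].
  have [N uN] := uC (complex.Re e / 2) (divr_gt0 e0 (ltr0n _ 2)).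
  exists (u N); exists N => // n Nn /=.
  rewrite -ball_normE /ball_ /=.
  rewrite rnormE ltcE eI /= eqxx /=.
  apply: le_lt_trans (uN _ _ (leqnn _) Nn) _.
  by rewrite ltr_pdivrMr// ltr_pMr// ltr1n.
move=> /cauchy_cvgP/cvg_ex[l /cvgrPdist_lt ul]; exists l => e e0.
have /ul[N _ Nu] : 0 < e%:C by rewrite ltcR.
exists N => n nN; have := Nu n nN.
by rewrite rnormE ltcR => /ltW.
Qed.

(** * Coercive equations and the adjoint *)

(** The form in which [e] tends to 0 in the estimates below. The proviso [e <= 1] allows a caller to
    bound [e ^ 2] by [e]. *)
Lemma le0_of_small_bounds (d K : R) : (forall e, 0 < e -> e <= 1 -> d <= K * e) -> d <= 0.
Proof.
move=> h; rewrite leNgt; apply/negP => d0.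
have K0 : 0 < `|K| + 1 by rewrite ltr_wpDl.
have := h (Num.min 1 (d / (2 * (`|K| + 1)))).
rewrite lt_min ltr01 divr_gt0 ?mulr_gt0//= ge_min lexx => /(_ isT isT).
apply/negP; rewrite -ltNge.
apply: (@le_lt_trans _ _ ((`|K| + 1) * (d / (2 * (`|K| + 1))))).
  apply: (@le_trans _ _ ((`|K| + 1) * Num.min 1 (d / (2 * (`|K| + 1))))).
    rewrite ler_wpM2r//.
      by rewrite le_min ler01 divr_ge0 ?(ltW d0)// mulr_ge0// ltW.
    by rewrite (le_trans (ler_norm _))// lerDl.
  by rewrite ler_wpM2l ?(ltW K0)// ge_min lexx orbT.
have -> : (`|K| + 1) * (d / (2 * (`|K| + 1))) = d / 2 by field; rewrite gt_eqF.
by rewrite ltr_pdivrMr// ltr_pMr// ltr1n.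
Qed.

Lemma inv_nat_le e : 0 < e -> exists N, forall n, (N <= n)%N -> n.+1%:R^-1 <= e.
Proof.
move=> e0; exists (Num.trunc e^-1) => n Nn.
rewrite -[leRHS]invrK lef_pV2 ?posrE ?invr_gt0 ?ltr0n//.
apply/ltW; apply: lt_le_trans (truncnS_gt _) _.
by rewrite ler_nat ltnS.
Qed.

Definition selfadjoint T := forall x y, dot (T x) y = dot x (T y).

Lemma selfadjoint_rdot T x y : selfadjoint T -> rdot (T x) y = rdot x (T y).
Proof. by move=> sT; rewrite /rdot sT. Qed.

(* The solution minimises the energy [rdot (S x) x - 2 phi x]; a vector whose
   energy is within [e] of the infimum satisfies the equation up to [sqrt e]. *)
Lemma symmetric_lax_milgram S (phi : H -> R) c (C : R) :
  bounded_op S -> selfadjoint S -> 0 < c ->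
  (forall x, c * rnorm x ^+ 2 <= rdot (S x) x) ->
  {morph phi : x y / x + y} -> (forall r x, phi (r%:C *: x) = r * phi x) ->
  (forall x, phi x <= C * rnorm x) ->
  exists l, forall z, rdot (S l) z = phi z.
Proof.
move=> /bounded_opP[lS [M M0 SM]] sS c0 Sc phiD phiZ phiC.
pose J x := rdot (S x) x - 2 * phi x.
have JD x z t : J (x + t%:C *: z) =
    rdot (S z) z * t ^+ 2 + 2 * (rdot (S x) z - phi z) * t + J x.
  rewrite /J (linear_opD lS) (linear_opZ lS) phiD phiZ !rdotE.
  rewrite (selfadjoint_rdot z x sS) [rdot z (S x)]rdotC; ring.
(* Coercivity gives [J x >= c r ^ 2 - 2 C r] with [r = rnorm x]; completing the square bounds this
   below. *)
have Jlb x : - (C ^+ 2 / c) <= J x.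
  have := Sc x; have := phiC x; rewrite /J => h1 h2.
  suff : 0 <= c * rnorm x ^+ 2 - 2 * (C * rnorm x) + C ^+ 2 / c by lra.
  have -> : c * rnorm x ^+ 2 - 2 * (C * rnorm x) + C ^+ 2 / c =
      (c * rnorm x - C) ^+ 2 / c by field; rewrite gt_eqF.
  by rewrite divr_ge0 ?sqr_ge0// ltW.
have Jinf : has_inf (range J).
  split; first by exists (J 0), 0.
  by exists (- (C ^+ 2 / c)) => _ [x _ <-].
set j := inf (range J).
have jJ x : j <= J x by apply: (ge_inf Jinf.2); exists x.
have /choice[u uJ] n : exists x, J x < j + n.+1%:R^-1.
  have i0 : 0 < n.+1%:R^-1 :> R by rewrite invr_gt0 ltr0n.
  by have [_ [x _ <-] xJ] := inf_adherent i0 Jinf; exists x.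
have Sz0 z : 0 <= rdot (S z) z.
  by apply: le_trans (Sc z); rewrite mulr_ge0 ?sqr_ge0// ltW.
(* The quadratic [J (u n + t z) - j] in [t] is nonnegative, so its discriminant is not positive. *)
have euler n z : (rdot (S (u n)) z - phi z) ^+ 2 <= rdot (S z) z * n.+1%:R^-1.
  apply: (@le_trans _ _ (rdot (S z) z * (J (u n) - j))).
    apply: sqr_le_of_quadratic_ge0 => // t.
    have := jJ (u n + t%:C *: z); rewrite JD; lra.
  by rewrite ler_wpM2l// lerBlDr addrC ltW.
(* The test vector is [z = u m - u n] itself. With [D = <S z, z>] equal to the difference of the two
   residuals, each of square at most [D * i], one gets [D ^ 2 <= 4 * D * i]. *)
have diff N m n : (N <= m)%N -> (N <= n)%N ->
    c * rnorm (u m - u n) ^+ 2 <= 4 * N.+1%:R^-1.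
  move=> Nm Nn; set z := u m - u n.
  apply: le_trans (Sc z) _.
  have Nle k : (N <= k)%N -> (rdot (S (u k)) z - phi z) ^+ 2 <= rdot (S z) z * N.+1%:R^-1.
    move=> Nk; apply: le_trans (euler k z) _; rewrite ler_wpM2l//.
    by rewrite lef_pV2 ?posrE ?ltr0n// ler_nat.
  have := Nle m Nm; have := Nle n Nn.
  have : rdot (S z) z = (rdot (S (u m)) z - phi z) - (rdot (S (u n)) z - phi z).
    by rewrite {1}/z (linear_opB lS) !rdotE; ring.
  have := Sz0 z; set D := rdot _ z; set a := _ - phi z; set b := rdot _ z - phi z.
  set i := N.+1%:R^-1 => D0 Dab hb ha.
  have [->|Dn0] := eqVneq D 0; first by rewrite /i mulr_ge0 ?invr_ge0.
  have Dp : 0 < D by rewrite lt_def Dn0.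
  rewrite -(ler_pM2l Dp).
  have := sqr_ge0 (a + b); rewrite {1}Dab; nra.
have [] := @complete_seq u.
  move=> e e0.
  have [N Ne] := @inv_nat_le (c * e ^+ 2 / 4)
    (divr_gt0 (mulr_gt0 c0 (exprn_gt0 _ e0)) (ltr0n _ 4)).
  exists N => m n Nm Nn.
  rewrite -ler_sqr ?nnegrE ?rnorm_ge0 ?(ltW e0)// -(ler_pM2l c0).
  apply: le_trans (diff N m n Nm Nn) _.
  by rewrite mulrC -ler_pdivlMr// Ne.
move=> l ul; exists l => z; apply/eqP; rewrite -subr_eq0 -sqrf_eq0.
rewrite eq_le sqr_ge0 andbT.
(* The residual at [l] is [<S (l - u n), z>] plus the residual at [u n]; the constant comes from
   [(a + b) ^ 2 <= 2 a ^ 2 + 2 b ^ 2]. *)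
apply: (@le0_of_small_bounds _ (2 * (M * rnorm z) ^+ 2 + 2 * rdot (S z) z)) => e e0 e1.
have [N1 h1] := ul e e0; have [N2 h2] := inv_nat_le e0.
set n := maxn N1 N2.
have := h1 n (leq_maxl _ _); have := h2 n (leq_maxr _ _) => i2 i1.
have hb := le_trans (euler n z) (ler_wpM2l (Sz0 z) i2).
have ha : (rdot (S (l - u n)) z) ^+ 2 <= (M * rnorm z) ^+ 2 * e.
  apply: (@le_trans _ _ ((M * rnorm z) ^+ 2 * e ^+ 2)); last first.
    rewrite ler_wpM2l ?sqr_ge0// expr2 -[leRHS]mulr1 ler_wpM2l//; exact: ltW.
  rewrite -exprMn -[leLHS]real_normK ?num_real// ler_sqr ?nnegrE//; last first.
    by rewrite !mulr_ge0 ?rnorm_ge0// ltW.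
  have hn : rnorm (S (l - u n)) * rnorm z <= M * rnorm z * e.
    rewrite mulrAC ler_wpM2r ?rnorm_ge0//.
    by apply: le_trans (SM _) _; rewrite ler_wpM2l.
  rewrite ler_norml; apply/andP; split.
    rewrite lerNl -rdotNl; apply: le_trans (rdot_le _ _) _.
    by rewrite rnormN.
  exact: le_trans (rdot_le _ _) hn.
have -> : rdot (S l) z - phi z = rdot (S (l - u n)) z + (rdot (S (u n)) z - phi z).
  by rewrite (linear_opB lS) !rdotE; ring.
move: ha hb; set a := rdot (S (l - _)) z; set b := _ - phi z => ha hb.
have := sqr_ge0 (a - b); nra.
Qed.

Lemma rdot_eq x y : (forall z, rdot x z = rdot y z) -> x = y.
Proof.
move=> h; apply/eqP; rewrite -subr_eq0; apply/eqP/rnorm_eq0/eqP.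
by rewrite -sqrf_eq0 -rdotxx rdotBl h subrr.
Qed.

Lemma Im_dot x y : complex.Im (dot x y) = - rdot ('i *: x) y.
Proof. by rewrite /rdot dotZl mulrC ReiNIm opprK. Qed.

(** The imaginary part of [<x, y>] is minus the real part of [<i x, y>]. Identities obtained from
    real functionals thus become complex ones. *)
Lemma dot_rdot x y x' y' :
  rdot x y = rdot x' y' -> rdot ('i *: x) y = rdot ('i *: x') y' -> dot x y = dot x' y'.
Proof.
by move=> h1 h2; apply/eqP; rewrite eq_complex !Im_dot h2 -/(rdot x y) h1 !eqxx.
Qed.

(** The variational lemma with the functional [<y, .>] solves [S l = y]. Coercivity makes the
    solution unique and, with Cauchy-Schwarz, bounds the inverse by [c^-1]. *)
Lemma coercive_invertible S c : bounded_op S -> selfadjoint S -> 0 < c ->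
  (forall x, c * rnorm x ^+ 2 <= rdot (S x) x) -> op_invertible S.
Proof.
move=> bS sS c0 Sc; have [lS _] := bS.
have /choice[G SG] y : exists l, S l = y.
  have [|||l hl] := @symmetric_lax_milgram S (rdot y) c (rnorm y) bS sS c0 Sc.
  - by move=> ? ?; rewrite rdotDr.
  - by move=> ? ?; rewrite rdotZr.
  - by move=> ?; apply: rdot_le.
  - by exists l; apply: rdot_eq.
have inj : injective S.
  move=> x y Sxy; apply/eqP; rewrite -subr_eq0; apply/eqP/rnorm_eq0/eqP.
  have := Sc (x - y); rewrite (linear_opB lS) Sxy subrr.
  have -> : rdot 0 (x - y) = 0 by rewrite -(scale0r 0) (rdotZl 0) mul0r.
  by rewrite pmulr_rle0// -sqrf_eq0 eq_le sqr_ge0 andbT.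
exists G; last by split=> // x; apply: inj; rewrite SG.
apply/bounded_opP; split.
  by move=> a x y; apply: inj; rewrite lS !SG.
exists c^-1; first by rewrite invr_ge0 ltW.
move=> x; rewrite mulrC ler_pdivlMr//.
have [->|Gn0] := eqVneq (rnorm (G x)) 0; first by rewrite mul0r rnorm_ge0.
have Gp : 0 < rnorm (G x) by rewrite lt_def Gn0 rnorm_ge0.
rewrite -(ler_pM2r Gp) mulrAC -expr2 mulrC.
by apply: le_trans (Sc _) _; rewrite SG; exact: rdot_le.
Qed.

(** Riesz representation is the variational lemma with [S = id], applied to the real functional
    [x |-> Re <T x, y>]; complex linearity of [T] then recovers the imaginary part. *)
Lemma adjointP T : bounded_op T ->
  bounded_op (adjoint dot T) /\ forall x y, dot (T x) y = dot x (adjoint dot T y).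
Proof.
move=> /bounded_opP[lT [M M0 TM]].
apply: (@xgetPex _ (fun=> 0)
  [set S | bounded_op S /\ forall x y, dot (T x) y = dot x (S y)]).
have idb : bounded_op (@id H).
  by apply/bounded_opP; split=> //; exists 1 => // x; rewrite mul1r.
have /choice[G hG] y : exists l, forall x, dot (T x) y = dot x l.
  have [||||||l hl] := @symmetric_lax_milgram id (fun x => rdot (T x) y) 1 (M * rnorm y) idb.
  - by [].
  - by [].
  - by move=> x; rewrite mul1r rdotxx.
  - by move=> ? ?; rewrite (linear_opD lT) rdotDl.
  - by move=> ? ?; rewrite (linear_opZ lT) rdotZl.
  - move=> x; apply: le_trans (rdot_le _ _) _.
    by rewrite mulrAC ler_wpM2r ?rnorm_ge0.
  - exists l => x; apply: dot_rdot; first by rewrite -hl rdotC.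
    by rewrite -(linear_opZ lT) -hl rdotC.
exists G; split=> //; apply/bounded_opP; split.
  move=> a x y; apply: rdot_eq => z; rewrite rdotC [RHS]rdotC /rdot.
  by rewrite -hG !dotDr !dotZr !hG.
exists M => // y.
have [->|Gn0] := eqVneq (rnorm (G y)) 0; first by rewrite mulr_ge0 ?rnorm_ge0.
have Gp : 0 < rnorm (G y) by rewrite lt_def Gn0 rnorm_ge0.
rewrite -(ler_pM2r Gp) -expr2 -rdotxx /rdot -hG.
apply: le_trans (rdot_le _ _) _.
by rewrite mulrAC ler_wpM2r ?rnorm_ge0.
Qed.

(** * Polynomials of an operator and its spectrum *)

Lemma conj_real r : Num.conj r%:C = r%:C.
Proof. by rewrite conj_Creal//; apply/complex_realP; exists r. Qed.

(** Coefficients are complex because a real polynomial splits into linear factors only over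
    [R[i]]. *)
Definition cpoly_op (P : {poly R[i]}) T : H -> H :=
  fun x => \sum_(i < size P) P`_i *: iter i T x.

Lemma poly_opE p T x : poly_op p T x = cpoly_op (map_poly (real_complex R) p) T x.
Proof.
rewrite /poly_op /cpoly_op size_map_poly.
by apply: eq_bigr => i _; rewrite coef_map.
Qed.

Lemma cpoly_op_widen n (P : {poly R[i]}) T x : (size P <= n)%N ->
  cpoly_op P T x = \sum_(i < n) P`_i *: iter i T x.
Proof.
move=> Pn; rewrite /cpoly_op (big_ord_widen n (fun i => P`_i *: iter i T x))//.
rewrite big_mkcond/=; apply: eq_bigr => i _.
by case: ltnP => // /leq_sizeP ->; rewrite ?scale0r.
Qed.

Lemma cpoly_opD (P Q : {poly R[i]}) T x :
  cpoly_op (P + Q) T x = cpoly_op P T x + cpoly_op Q T x.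
Proof.
pose n := maxn (size P) (size Q).
rewrite !(@cpoly_op_widen n) ?leq_maxl ?leq_maxr ?size_polyD// -big_split/=.
by apply: eq_bigr => i _; rewrite coefD scalerDl.
Qed.

Lemma cpoly_opC (a : R[i]) T x : cpoly_op a%:P T x = a *: x.
Proof. by rewrite (@cpoly_op_widen 1) ?size_polyC_leq1// big_ord1 coefC. Qed.

Lemma cpoly_opZ (a : R[i]) (P : {poly R[i]}) T x : cpoly_op (a *: P) T x = a *: cpoly_op P T x.
Proof.
rewrite !(@cpoly_op_widen (size P)) ?size_scale_leq// scaler_sumr.
by apply: eq_bigr => i _; rewrite coefZ scalerA.
Qed.

Lemma cpoly_opMX (P : {poly R[i]}) T x :
  cpoly_op (P * 'X) T x = cpoly_op P T (T x).
Proof.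
rewrite (@cpoly_op_widen (size P).+1); last first.
  by rewrite (leq_trans (size_polyMleq _ _))// size_polyX addn2.
rewrite big_ord_recl coefMX/= scale0r add0r; apply: eq_bigr => i _.
by rewrite coefMX/= -iterSr.
Qed.

Lemma cpoly_op_linear (P : {poly R[i]}) T : linear T -> linear (cpoly_op P T).
Proof.
move=> lT; elim/poly_ind: P => [|P a IH] b x y.
  by rewrite -!polyC0 !cpoly_opC !scale0r scaler0 addr0.
rewrite !cpoly_opD !cpoly_opMX !cpoly_opC lT IH !scalerDr !scalerA.
by rewrite [a * b]mulrC addrACA.
Qed.

Lemma cpoly_opM (P Q : {poly R[i]}) T x : linear T ->
  cpoly_op (P * Q) T x = cpoly_op P T (cpoly_op Q T x).
Proof.
move=> lT; have lP := cpoly_op_linear P lT.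
elim/poly_ind: Q x => [|Q a IH] x.
  by rewrite mulr0 -!polyC0 !cpoly_opC !scale0r (linear_op0 lP).
rewrite mulrDr !cpoly_opD mulrA !cpoly_opMX IH (linear_opD lP); congr (_ + _).
by rewrite cpoly_opC (linear_opZ lP) mulrC mul_polyC cpoly_opZ.
Qed.

Lemma cpoly_op_bounded (P : {poly R[i]}) T : bounded_op T -> bounded_op (cpoly_op P T).
Proof.
move=> /bounded_opP[lT [M M0 TM]]; apply/bounded_opP; split; first exact: cpoly_op_linear.
elim/poly_ind: P => [|P a [c c0 IH]].
  by exists 0 => // x; rewrite -polyC0 cpoly_opC scale0r rnorm0 mul0r.
have a0 := Re_norm_ge0 a.
exists (c * M + complex.Re `|a|); first by rewrite addr_ge0// mulr_ge0.
move=> x; rewrite cpoly_opD cpoly_opMX cpoly_opC mulrDl.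
apply: le_trans (rnormD _ _) _; rewrite rnormZ lerD2r.
by apply: le_trans (IH _) _; rewrite -mulrA ler_wpM2l.
Qed.

Lemma poly_op_bounded p T : bounded_op T -> bounded_op (poly_op p T).
Proof.
move=> bT; have -> : poly_op p T = cpoly_op (map_poly (real_complex R) p) T.
  by apply/funext => x; exact: poly_opE.
exact: cpoly_op_bounded.
Qed.

Lemma poly_opD p q T x : poly_op (p + q) T x = poly_op p T x + poly_op q T x.
Proof. by rewrite !poly_opE rmorphD cpoly_opD. Qed.

Lemma poly_opC r T x : poly_op r%:P T x = r%:C *: x.
Proof. by rewrite poly_opE map_polyC cpoly_opC. Qed.

Lemma poly_opX T x : poly_op 'X T x = T x.
Proof. by rewrite poly_opE map_polyX -['X]mul1r cpoly_opMX cpoly_opC scale1r. Qed.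

Lemma poly_opM p q T x : linear T -> poly_op (p * q) T x = poly_op p T (poly_op q T x).
Proof. by move=> lT; rewrite !poly_opE rmorphM cpoly_opM. Qed.

Lemma poly_opB p q T x : linear T -> poly_op (p - q) T x = poly_op p T x - poly_op q T x.
Proof.
move=> lT; rewrite poly_opD -mulN1r -polyCN poly_opM// poly_opC.
by rewrite rmorphN1 scaleN1r.
Qed.

Lemma poly_op_selfadjoint p T : linear T -> selfadjoint T -> selfadjoint (poly_op p T).
Proof.
move=> lT sT; elim/poly_ind: p => [|p r IH] x y.
  by rewrite -!polyC0 !poly_opC !scale0r linear0l linear0r.
rewrite !poly_opD [in RHS]mulrC !poly_opM// !poly_opX !poly_opC.
rewrite dotDl dotDr dotZl dotZr IH sT.
by rewrite conj_real.
Qed.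

(** * Operator norm and the bound by the spectrum *)

Lemma norm_le1 x : (`|x| <= 1) = (rnorm x <= 1).
Proof. by rewrite rnormE -lecR. Qed.

Lemma opnorm_has_sup T : bounded_op T ->
  has_sup [set complex.Re `|T x| | x in [set x : H | `|x| <= 1]].
Proof.
move=> /bounded_opP[lT [M M0 TM]]; split.
  by exists (rnorm (T 0)), 0 => //=; rewrite normr0.
exists M => _ [x /= + <-]; rewrite norm_le1 => x1.
by apply: le_trans (TM x) _; rewrite -[leRHS]mulr1 ler_wpM2l.
Qed.

Lemma opnorm_ge0 T : bounded_op T -> 0 <= opnorm T.
Proof.
move=> bT; apply: le_trans (ub_le_sup (opnorm_has_sup bT).2 _).
  exact: (rnorm_ge0 (T 0)).
by exists 0 => //=; rewrite normr0.
Qed.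

Lemma rnorm_le_opnorm T x : bounded_op T -> rnorm (T x) <= opnorm T * rnorm x.
Proof.
move=> bT; have [lT _] := bT; have [x0|x0] := eqVneq (rnorm x) 0.
  by rewrite (rnorm_eq0 x0) (linear_op0 lT) rnorm0 mulr0.
have xp : 0 < rnorm x by rewrite lt_def x0 rnorm_ge0.
rewrite -ler_pdivrMr//.
have -> : rnorm (T x) / rnorm x = rnorm (T ((rnorm x)^-1%:C *: x)).
  by rewrite (linear_opZ lT) rnormZr ger0_norm ?invr_ge0 ?rnorm_ge0// mulrC.
apply: (ub_le_sup (opnorm_has_sup bT).2).
exists ((rnorm x)^-1%:C *: x) => //=.
by rewrite norm_le1 rnormZr ger0_norm ?invr_ge0 ?rnorm_ge0// mulVf.
Qed.

Lemma opnorm_le T c : 0 <= c -> (forall x, rnorm (T x) <= c * rnorm x) -> opnorm T <= c.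
Proof.
move=> c0 Tc; apply: ge_sup.
  by exists (rnorm (T 0)), 0 => //=; rewrite normr0.
move=> _ [x /= + <-]; rewrite norm_le1 => x1.
by apply: le_trans (Tc x) _; rewrite -[leRHS]mulr1 ler_wpM2l.
Qed.

(** Its failure for [T - a] says that [a] is an approximate eigenvalue. The property passes to
    compositions, which suits factored polynomials. *)
Definition bounded_below T := exists2 c, 0 < c & forall x, c * rnorm x <= rnorm (T x).

(** Expanding, [|S (S x) - m ^ 2 x| ^ 2 <= m ^ 4 |x| ^ 2 - m ^ 2 |S x| ^ 2]. A lower bound [d |x|]
    would give [|S x| ^ 2 <= (m ^ 2 - d ^ 2 / m ^ 2) |x| ^ 2], and the norm would be smaller than
    [m]. *)
Lemma opnorm_not_bounded_below S : bounded_op S -> selfadjoint S -> 0 < opnorm S ->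
  ~ bounded_below (fun x => S (S x) - (opnorm S ^+ 2)%:C *: x).
Proof.
move=> bS sS m0 [d d0 hd]; set m := opnorm S in m0 hd.
have Sm x : rnorm (S x) ^+ 2 <= (m ^+ 2 - d ^+ 2 / m ^+ 2) * rnorm x ^+ 2.
  have := hd x; rewrite -ler_sqr ?nnegrE ?mulr_ge0 ?rnorm_ge0 ?(ltW d0)// -[leRHS]rdotxx.
  have e : rdot (S (S x)) x = rnorm (S x) ^+ 2.
    by rewrite (selfadjoint_rdot _ _ sS) rdotxx.
  rewrite !rdotE !rdotxx [rdot x (S _)]rdotC e.
  rewrite exprMn => h2.
  have h1 : rnorm (S (S x)) ^+ 2 <= m ^+ 2 * rnorm (S x) ^+ 2.
    rewrite -exprMn ler_sqr ?nnegrE ?mulr_ge0 ?rnorm_ge0 ?(ltW m0)//.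
    exact: rnorm_le_opnorm.
  have m20 : 0 < m ^+ 2 by rewrite exprn_gt0.
  rewrite -(ler_pM2l m20).
  have -> : m ^+ 2 * ((m ^+ 2 - d ^+ 2 / m ^+ 2) * rnorm x ^+ 2) =
     (m ^+ 2 * m ^+ 2 - d ^+ 2) * rnorm x ^+ 2 by field; rewrite gt_eqF.
  lra.
set k := m ^+ 2 - _ in Sm.
have km : k < m ^+ 2 by rewrite ltrBlDr ltrDl divr_gt0 ?exprn_gt0.
(* The sign of [k] is not known at this point, hence the maximum under the root. *)
have mk : m <= Num.sqrt (Num.max k 0).
  apply: opnorm_le; first exact: sqrtr_ge0.
  move=> x; rewrite -ler_sqr ?nnegrE ?mulr_ge0 ?rnorm_ge0 ?sqrtr_ge0//.
  rewrite exprMn sqr_sqrtr; last by rewrite le_max lexx orbT.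
  by apply: le_trans (Sm x) _; rewrite ler_wpM2r ?sqr_ge0// le_max lexx.
have : m ^+ 2 <= Num.max k 0.
  rewrite -[leRHS]sqr_sqrtr; last by rewrite le_max lexx orbT.
  by rewrite ler_sqr ?nnegrE ?sqrtr_ge0// ltW.
by rewrite le_max leNgt km/= leNgt exprn_gt0.
Qed.

Lemma cpoly_op_XsubC (a : R[i]) T x : cpoly_op ('X - a%:P) T x = T x - a *: x.
Proof.
rewrite cpoly_opD -polyCN cpoly_opC -['X]mul1r cpoly_opMX -polyC1 cpoly_opC.
by rewrite scale1r scaleNr.
Qed.

Lemma bounded_below_prod (s : seq R[i]) T : linear T ->
  (forall a, a \in s -> bounded_below (fun x => T x - a *: x)) ->
  bounded_below (cpoly_op (\prod_(a <- s) ('X - a%:P)) T).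
Proof.
move=> lT; elim: s => [|a s IH] hs.
  by exists 1 => // x; rewrite big_nil cpoly_opC scale1r mul1r.
have [c c0 hc] := IH (fun b bs => hs b (@mem_behead _ (a :: s) b bs)).
have [d d0 hd] := hs a (mem_head _ _).
exists (d * c); first exact: mulr_gt0.
move=> x; rewrite big_cons cpoly_opM// cpoly_op_XsubC.
apply: le_trans (hd _); rewrite -mulrA ler_wpM2l ?(ltW d0)//; exact: hc.
Qed.

(** [<T x, x>] is real, so the imaginary part of [<(T - a) x, x>] is [- Im a * |x| ^ 2];
    Cauchy-Schwarz concludes. *)
Lemma bounded_below_nonreal T (a : R[i]) : selfadjoint T -> complex.Im a != 0 ->
  bounded_below (fun x => T x - a *: x).
Proof.
move=> sT a0; exists `|complex.Im a|; first by rewrite normr_gt0.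
move=> x; have [x0|x0] := eqVneq (rnorm x) 0; first by rewrite x0 mulr0 rnorm_ge0.
have xp : 0 < rnorm x by rewrite lt_def x0 rnorm_ge0.
rewrite -(ler_pM2r xp); apply: le_trans (dot_le _ _).
have Tx : complex.Im (dot (T x) x) = 0.
  have := congr1 (@complex.Im R) (dotC (T x) x).
  by rewrite -sT Im_conjC; lra.
have : complex.Im (dot (T x - a *: x) x) = - (complex.Im a * rnorm x ^+ 2).
  rewrite dotDl -scaleNr dotZl dot_real raddfD /= Tx.
  by case: (a) => u v /=; rewrite mulr0 add0r add0r mulNr.
move=> h; rewrite -mulrA -expr2 -[_ ^+ 2]ger0_norm ?sqr_ge0// -normrM -normrN -h.
rewrite normc_def/= -sqrtr_sqr ler_sqrt ?lerDr ?sqr_ge0//.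
by rewrite addr_ge0 ?sqr_ge0.
Qed.

Lemma spectrum_not_bounded_below T (a : R[i]) :
  ~ bounded_below (fun x => T x - a *: x) -> spectrum T a.
Proof.
move=> nb [S /bounded_opP[lS [M M0 SM]] [TS _]]; apply: nb.
exists (M + 1)^-1; first by rewrite invr_gt0 ltr_wpDl.
move=> x; rewrite mulrC ler_pdivrMr ?ltr_wpDl// mulrC -{1}[x]TS.
by apply: le_trans (SM _) _; rewrite ler_wpM2r ?rnorm_ge0// lerDl.
Qed.

Lemma spectrum_root T p : linear T -> selfadjoint T -> p != 0 ->
  ~ bounded_below (poly_op p T) -> exists2 t, spectrum T t%:C & root p t.
Proof.
move=> lT sT p0 nb.
pose P := map_poly (real_complex R) p.
have [s Ps] := closed_field_poly_normal P.
have P0 : lead_coef P != 0 by rewrite lead_coef_eq0 map_poly_eq0.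
have [z zs nz] : exists2 z : R[i], z \in s & ~ bounded_below (fun x => T x - z *: x).
  apply: contrapT => h; apply: nb.
  have [z zs|c c0 hc] := @bounded_below_prod s T lT.
    by apply: contrapT => nz; apply: h; exists z.
  have l0 : 0 < complex.Re `|lead_coef P|.
    by rewrite -ltcR RRe_real ?normr_real// normr_gt0.
  exists (complex.Re `|lead_coef P| * c); first exact: mulr_gt0.
  move=> x; rewrite poly_opE -/P {2}Ps cpoly_opZ rnormZ -mulrA ler_wpM2l ?(ltW l0)//; exact: hc.
have [zI|zI] := eqVneq (complex.Im z) 0; last by case: nz; exact: bounded_below_nonreal.
have zE : z = (complex.Re z)%:C by apply/eqP; rewrite eq_complex /= zI !eqxx.
exists (complex.Re z); first by rewrite -zE; exact: spectrum_not_bounded_below.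
have : root P z by rewrite Ps rootZ// root_prod_XsubC.
by rewrite zE /P fmorph_root.
Qed.

Lemma poly_op_sqrB p T r : linear T ->
  poly_op (p ^+ 2 - r%:P) T = fun x => poly_op p T (poly_op p T x) - r%:C *: x.
Proof.
by move=> lT; apply/funext => x; rewrite poly_opB// poly_opC expr2 poly_opM.
Qed.

(** A bound over an empty spectrum could be negative; this excludes it in a nonzero space, of which
    [x] is the witness. If the norm [m] of [T] is 0, the point is 0; otherwise it is a root of
    [X ^ 2 - m ^ 2]. *)
Lemma spectrum_neq0 T x : bounded_op T -> selfadjoint T -> x != 0 ->
  exists t, spectrum T t%:C.
Proof.
move=> bT sT x0; have [lT _] := bT.
have [m0|m0] := eqVneq (opnorm T) 0.
  exists 0 => -[S [lS _] [TS _]].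
  move/eqP: x0; apply; rewrite -[x]TS.
  have -> : T x = 0.
    apply: rnorm_eq0; apply/eqP; rewrite eq_le rnorm_ge0 andbT.
    by apply: le_trans (rnorm_le_opnorm _ bT) _; rewrite m0 mul0r.
  by rewrite scale0r subr0 (linear_op0 lS).
have mp : 0 < opnorm T by rewrite lt_def m0 opnorm_ge0.
have [||t tT _] := @spectrum_root T ('X ^+ 2 - (opnorm T ^+ 2)%:P) lT sT.
- rewrite -size_poly_eq0 size_polyDl ?size_polyXn// size_polyN.
  by rewrite (leq_ltn_trans (size_polyC_leq1 _)).
- rewrite poly_op_sqrB//.
  have -> : poly_op 'X T = T by apply/funext => y; exact: poly_opX.
  exact: opnorm_not_bounded_below.
- by exists t.
Qed.

Theorem spectral_bound T p c : bounded_op T -> selfadjoint T ->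
  (forall t, spectrum T t%:C -> `|p.[t]| <= c) ->
  forall x, rnorm (poly_op p T x) <= c * rnorm x.
Proof.
move=> bT sT pc x; have [lT _] := bT.
have bS := poly_op_bounded p bT; have sS := poly_op_selfadjoint p lT sT.
have [->|x0] := eqVneq x 0.
  by rewrite (linear_op0 bS.1) rnorm0 mulr0.
have [t0 /pc h0] := spectrum_neq0 bT sT x0.
have c0 := le_trans (normr_ge0 _) h0.
suff mc : opnorm (poly_op p T) <= c.
  apply: le_trans (rnorm_le_opnorm _ bS) _.
  by rewrite ler_wpM2r ?rnorm_ge0.
rewrite leNgt; apply/negP => cm.
set m := opnorm _ in cm.
have c2m t : `|p.[t]| <= c -> p.[t] ^+ 2 < m ^+ 2.
  move=> h; rewrite -[ltLHS]real_normK ?num_real//.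
  rewrite ltr_pXn2r ?nnegrE ?(le_trans c0 (ltW cm))//.
  exact: le_lt_trans h cm.
have rE t : (p ^+ 2 - (m ^+ 2)%:P).[t] = p.[t] ^+ 2 - m ^+ 2.
  by rewrite hornerD hornerN hornerC horner_exp.
(* On the spectrum [|p| <= c < m], so [p ^ 2 - m ^ 2] is negative there. At [t0] this shows that the
   polynomial is nonzero, and at [t] it contradicts the root. *)
have [||t /pc tT /rootP] := @spectrum_root T (p ^+ 2 - (m ^+ 2)%:P) lT sT.
- apply/eqP => r0; have := rE t0; rewrite r0 horner0 => /esym/eqP.
  by rewrite subr_eq0 => /eqP e; have := c2m _ h0; rewrite e ltxx.
- rewrite poly_op_sqrB//; apply: opnorm_not_bounded_below => //.
  exact: le_lt_trans cm.
- by rewrite rE => /eqP; rewrite subr_eq0 => /eqP e; have := c2m _ tT; rewrite e ltxx.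
Qed.

(* [T - t] or [t - T] is coercive for [t] outside [0, M]. *)
Lemma spectrum_itv T (M : R) t : bounded_op T -> selfadjoint T ->
  (forall x, 0 <= rdot (T x) x) -> (forall x, rnorm (T x) <= M * rnorm x) ->
  spectrum T t%:C -> 0 <= t <= M.
Proof.
move=> bT sT T0 TM.
have bTt : bounded_op (fun x => T x - t%:C *: x).
  exact: bounded_opB bT (bounded_opZ _).
have sTt : selfadjoint (fun x => T x - t%:C *: x).
  by move=> x y; rewrite !(dotDl, dotDr, dotNl, dotNr, dotZl, dotZr) conj_real sT.
move=> tT; apply/andP; split; rewrite leNgt; apply/negP => h; apply: tT.
  apply: (@coercive_invertible _ (- t) bTt sTt); rewrite ?oppr_gt0//.
  by move=> x; rewrite !rdotE rdotxx; have := T0 x; lra.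
have [||||G bG [G1 G2]] := @coercive_invertible (fun x => - (T x - t%:C *: x)) (t - M).
- exact: bounded_opN.
- by move=> x y; rewrite dotNl dotNr; congr (- _); exact: sTt.
- by rewrite subr_gt0.
- move=> x; rewrite !rdotE rdotxx.
  have h1 := rdot_le (T x) x.
  have := ler_wpM2r (rnorm_ge0 x) (TM x); lra.
exists (fun x => - G x); first exact: bounded_opN.
split=> x; first by rewrite -(linear_opN bG.1) G1.
by rewrite -[RHS]G2 (linear_opN bTt.1).
Qed.

(** * Functional calculus of a positive operator *)

Definition positive_op T :=
  [/\ bounded_op T, selfadjoint T & forall x, 0 <= rdot (T x) x].

(** An existential counterpart of [is_cfc]: one good polynomial for each [e], a form that is easy to
    verify for sums, products and compositions. The spectral bound leads from it back to all
    polynomials. *)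
Definition is_fun_calculus (f : R -> R) T S := bounded_op S /\
  forall e, 0 < e -> exists2 p,
    forall t, spectrum T t%:C -> `|p.[t] - f t| <= e &
    forall x, rnorm (poly_op p T x - S x) <= e * rnorm x.

Lemma uniform_cvgP (A : set R) (u : nat -> {poly R}) (f : R -> R) :
  {uniform A, (fun n t => (u n).[t]) @ \oo --> f} <->
  forall e, 0 < e -> exists N, forall n, (N <= n)%N -> forall t, A t -> `|(u n).[t] - f t| <= e.
Proof.
split.
  move=> uf e e0.
  have /uf[N _ hN] : nbhs (f : {uniform` A -> R}) [set h | forall t, A t -> `|h t - f t| <= e].
    apply/uniform_nbhs; exists [set xy | ball xy.1 e xy.2]; split.
      exact: (entourage_ball _ (PosNum e0)).
    move=> h /= hh t At; have := hh t At.
    by rewrite -ball_normE /ball_/= distrC => /ltW.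
  by exists N.
move=> h P /uniform_nbhs[E [entE EP]].
move: entE; rewrite -entourage_ballE => -[e /= e0 eE].
have [N hN] := h (e / 2) (divr_gt0 e0 (ltr0n _ 2)).
exists N => // n /= Nn; apply: EP => t At; apply: eE => /=.
rewrite -ball_normE /ball_/= distrC; apply: le_lt_trans (hN n Nn t At) _.
by rewrite ltr_pdivrMr// ltr_pMr// ltr1n.
Qed.

Section FunctionalCalculus.
Variable T : H -> H.
Hypothesis T_pos : positive_op T.
Let T_bounded : bounded_op T. Proof. by case: T_pos. Qed.
Let T_linear : linear T. Proof. by case: T_bounded. Qed.
Let T_selfadjoint : selfadjoint T. Proof. by case: T_pos. Qed.
Implicit Types (f g : R -> R).

Lemma positive_spectrum : exists2 M : R, 0 < M &
  (forall t, spectrum T t%:C -> 0 <= t <= M) /\ (forall x, rnorm (T x) <= M * rnorm x).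
Proof.
have [_ [c c0 Tc]] := (bounded_opP T).1 T_bounded.
have Tc1 x : rnorm (T x) <= (c + 1) * rnorm x.
  by apply: le_trans (Tc x) _; rewrite ler_wpM2r ?rnorm_ge0// lerDl.
exists (c + 1); first by rewrite ltr_wpDl.
split=> // t; apply: spectrum_itv => //.
by case: T_pos.
Qed.

(** The polynomial [q] supplied for [e] is within [c + e] of [p] on the spectrum, so the spectral
    bound compares [p(T)] with [q(T)]; then [e] tends to 0. *)
Lemma fun_calculus_bound f S p c : is_fun_calculus f T S ->
  (forall t, spectrum T t%:C -> `|p.[t] - f t| <= c) ->
  forall x, rnorm (poly_op p T x - S x) <= c * rnorm x.
Proof.
move=> [_ fS] pc x; rewrite -subr_le0.
apply: (@le0_of_small_bounds _ (2 * rnorm x)) => e e0 _.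
have [q qf qS] := fS e e0.
have h1 : rnorm (poly_op p T x - poly_op q T x) <= (c + e) * rnorm x.
  rewrite -poly_opB//; apply: spectral_bound => // t tT.
  have -> : (p - q).[t] = (p.[t] - f t) - (q.[t] - f t).
    by rewrite hornerD hornerN; ring.
  by apply: le_trans (ler_normB _ _) _; apply: lerD; [exact: pc|exact: qf].
have := rnorm_triangle (poly_op q T x) (poly_op p T x) (S x).
have := qS x; lra.
Qed.

Lemma fun_calculus_unique f S S' :
  is_fun_calculus f T S -> is_fun_calculus f T S' -> S = S'.
Proof.
move=> [_ fS] fS'; apply/funext => x; apply/eqP; rewrite -subr_eq0.
apply/eqP/rnorm_eq0/eqP; rewrite eq_le rnorm_ge0 andbT.
apply: (@le0_of_small_bounds _ (2 * rnorm x)) => e e0 _.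
have [p pf pS] := fS e e0.
have := rnorm_triangle (poly_op p T x) (S x) (S' x).
have := fun_calculus_bound fS' pf x; have := pS x.
rewrite [rnorm (S x - poly_op _ _ _)]rnormB; lra.
Qed.

Lemma fun_calculus_ext f g S : (forall t, spectrum T t%:C -> f t = g t) ->
  is_fun_calculus f T S -> is_fun_calculus g T S.
Proof.
move=> fg [bS fS]; split=> // e /fS[p pf pS]; exists p => // t tT.
by rewrite -fg//; exact: pf.
Qed.

Lemma fun_calculus_is_cfc f S : is_fun_calculus f T S -> is_cfc f T S.
Proof.
move=> fS; split; first exact: fS.1.
move=> p /uniform_cvgP pf; apply/cvgr0Pnorm_le => e e0.
have [N hN] := pf e e0; exists N => // n /= Nn.
have h := fun_calculus_bound fS (hN n Nn).
have hle : opnorm (poly_op (p n) T \- S) <= e by apply: opnorm_le => //; exact: ltW.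
rewrite ger0_norm//; apply: opnorm_ge0.
exact: bounded_opB (poly_op_bounded _ T_bounded) fS.1.
Qed.

(** The chosen value is determined only if every [S'] with [is_cfc f T S'] equals [S]. Polynomials
    with error [1 / (n + 1)] converge to [S] by choice and to [S'] by [is_cfc]. *)
Lemma cfcE f S : is_fun_calculus f T S -> cfc f T = S.
Proof.
move=> fS; apply: xget_unique; first exact: fun_calculus_is_cfc.
move=> S' [bS' hS']; apply/funext => x; apply/eqP; rewrite -subr_eq0.
apply/eqP/rnorm_eq0/eqP; rewrite eq_le rnorm_ge0 andbT.
have /choice[p pP] n : exists p,
    (forall t, spectrum T t%:C -> `|p.[t] - f t| <= n.+1%:R^-1) /\
    forall x, rnorm (poly_op p T x - S x) <= n.+1%:R^-1 * rnorm x.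
  have i0 : 0 < n.+1%:R^-1 :> R by rewrite invr_gt0 ltr0n.
  by have [p p1 p2] := fS.2 _ i0; exists p.
have /hS'/cvgr0Pnorm_le pS' :
    {uniform [set t : R | spectrum T t%:C], (fun n t => (p n).[t]) @ \oo --> f}.
  apply/uniform_cvgP => e e0; have [N hN] := inv_nat_le e0.
  exists N => n Nn t tT; apply: le_trans (hN n Nn); exact: (pP n).1.
apply: (@le0_of_small_bounds _ (2 * rnorm x)) => e e0 _.
have [N1 _ h1] := pS' e e0; have [N2 h2] := inv_nat_le e0.
set n := maxn N1 N2.
have := h1 n (leq_maxl _ _) => /= /(le_trans (ler_norm _)) h1n.
have h2n := h2 n (leq_maxr _ _).
have := rnorm_triangle (poly_op (p n) T x) (S' x) (S x).
have := rnorm_le_opnorm x (bounded_opB (poly_op_bounded (p n) T_bounded) bS').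
have := (pP n).2 x; have := ler_wpM2r (rnorm_ge0 x) h1n.
have := ler_wpM2r (rnorm_ge0 x) h2n.
rewrite /= [rnorm (S' x - poly_op _ _ _)]rnormB.
clear; set i := _^-1 * _; set o := opnorm _ * _; set a := rnorm (S' x - S x).
set b := rnorm (_ - _); set d := rnorm (_ - _); lra.
Qed.

(** By the spectral bound the [p n (T) x] form Cauchy sequences. [S] is their pointwise limit, and
    the explicit rate, proportional to [rnorm x], yields its linearity and boundedness. *)
Lemma fun_calculus_exists f :
  (forall e, 0 < e -> exists p, forall t, spectrum T t%:C -> `|p.[t] - f t| <= e) ->
  exists S, is_fun_calculus f T S.
Proof.
move=> fW.
have /choice[p pP] n : exists p,
    (forall t, spectrum T t%:C -> `|p.[t] - f t| <= n.+1%:R^-1).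
  by apply: fW; rewrite invr_gt0 ltr0n.
have pC N m n : (N <= m)%N -> (N <= n)%N ->
    forall x, rnorm (poly_op (p m) T x - poly_op (p n) T x) <= 2 * N.+1%:R^-1 * rnorm x.
  move=> Nm Nn x; rewrite -poly_opB//; apply: spectral_bound => // t tT.
  have -> : (p m - p n).[t] = ((p m).[t] - f t) - ((p n).[t] - f t).
    by rewrite hornerD hornerN; ring.
  apply: le_trans (ler_normB _ _) _.
  rewrite mulr_natl mulr2n; apply: lerD.
    by apply: le_trans (pP m t tT) _; rewrite lef_pV2 ?posrE ?ltr0n// ler_nat.
  by apply: le_trans (pP n t tT) _; rewrite lef_pV2 ?posrE ?ltr0n// ler_nat.
have /choice[S hS] x : exists l, forall e, 0 < e ->
    exists N, forall n, (N <= n)%N -> rnorm (l - poly_op (p n) T x) <= e.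
  apply: complete_seq => e e0.
  have d0 : 0 < 2 * rnorm x + 1 by rewrite ltr_wpDl// mulr_ge0 ?rnorm_ge0.
  have [N hN] := inv_nat_le (divr_gt0 e0 d0).
  exists N => m n Nm Nn; apply: le_trans (pC N m n Nm Nn x) _.
  have := hN N (leqnn _); rewrite ler_pdivlMr//.
  have : 0 <= N.+1%:R^-1 :> R by rewrite invr_ge0.
  clear; move: (N.+1%:R^-1) (rnorm x) => i a i0 h; lra.
have pS n x : rnorm (poly_op (p n) T x - S x) <= 2 * n.+1%:R^-1 * rnorm x.
  rewrite -subr_le0; apply: (@le0_of_small_bounds _ 1) => e e0 _.
  have [N hN] := hS x e e0.
  have := hN (maxn N n) (leq_maxl _ _); have := pC n n (maxn N n) (leqnn _) (leq_maxr _ _) x.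
  have := rnorm_triangle (poly_op (p (maxn N n)) T x) (poly_op (p n) T x) (S x).
  rewrite [rnorm (S x - _)]rnormB; move: (n.+1%:R^-1) => i; lra.
have lp n := (poly_op_bounded (p n) T_bounded).1.
have lS : linear S.
  move=> a x y; apply/eqP; rewrite -subr_eq0; apply/eqP/rnorm_eq0/eqP.
  rewrite eq_le rnorm_ge0 andbT.
  have ra0 := Re_norm_ge0 a.
  apply: (@le0_of_small_bounds _ (2 * (rnorm (a *: x + y) + complex.Re `|a| * rnorm x + rnorm y))).
  move=> e e0 _; have [N hN] := inv_nat_le e0; have hNN := hN N (leqnn N).
  have -> : S (a *: x + y) - (a *: S x + S y) =
     - (poly_op (p N) T (a *: x + y) - S (a *: x + y)) +
     (a *: (poly_op (p N) T x - S x) + (poly_op (p N) T y - S y)).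
    by rewrite lp scalerBr [in RHS]opprB [X in _ = _ + X]addrACA -opprD addrA subrK.
  apply: le_trans (rnormD _ _) _; rewrite rnormN.
  have := rnormD (a *: (poly_op (p N) T x - S x)) (poly_op (p N) T y - S y).
  rewrite rnormZ.
  have := pS N (a *: x + y); have := ler_wpM2l ra0 (pS N x); have := pS N y.
  have := ler_wpM2r (rnorm_ge0 (a *: x + y)) hNN.
  have := ler_wpM2l ra0 (ler_wpM2r (rnorm_ge0 x) hNN).
  have := ler_wpM2r (rnorm_ge0 y) hNN.
  clear; move: (N.+1%:R^-1) => i; lra.
exists S; split.
  apply/bounded_opP; split=> //.
  have [_ [c c0 hc]] := (bounded_opP _).1 (poly_op_bounded (p 0%N) T_bounded).
  (* The 2 is the error rate [2 / (n + 1)] at [n = 0]. *)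
  exists (c + 2); first exact: addr_ge0.
  move=> x; have := hc x; have := pS 0%N x.
  have := rnormD (poly_op (p 0%N) T x) (S x - poly_op (p 0%N) T x).
  rewrite invr1 addrC subrK [rnorm (S x - _)]rnormB; lra.
move=> e e0; have [N hN] := inv_nat_le (divr_gt0 e0 (ltr0n _ 2)).
have hNN := hN N (leqnn N).
exists (p N).
  move=> t tT; apply: le_trans (pP N t tT) _; move: hNN; move: (N.+1%:R^-1) => i; lra.
move=> x; apply: le_trans (pS N x) _; rewrite ler_wpM2r ?rnorm_ge0//.
by move: hNN; move: (N.+1%:R^-1) => i; lra.
Qed.

Lemma poly_spectrum_bound p :
  exists2 B : R, 0 < B & forall t, spectrum T t%:C -> `|p.[t]| <= B.
Proof.
have [M M0 [TM _]] := positive_spectrum.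
have [B pB] := poly_itv_bound p 0 M.
exists (`|B| + 1); first by rewrite ltr_wpDl.
move=> t /TM/pB /le_trans; apply.
by apply: le_trans (ler_norm _) _; rewrite lerDl.
Qed.

Lemma fun_calculus_bounded f S : is_fun_calculus f T S ->
  exists2 B : R, 0 < B & forall t, spectrum T t%:C -> `|f t| <= B.
Proof.
move=> [_ /(_ 1 ltr01)[p pf _]]; have [B B0 pB] := poly_spectrum_bound p.
exists (B + 1); first exact: addr_gt0.
move=> t tT; have -> : f t = p.[t] - (p.[t] - f t) by ring.
by apply: le_trans (ler_normB _ _) _; apply: lerD; [exact: pB|exact: pf].
Qed.

Lemma fun_calculusC r : is_fun_calculus (fun=> r) T (fun x => r%:C *: x).
Proof.
split; first exact: bounded_opZ.
move=> e e0; exists r%:P => [t _|x]; first by rewrite hornerC subrr normr0 ltW.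
by rewrite poly_opC subrr rnorm0 mulr_ge0 ?rnorm_ge0 ?ltW.
Qed.

Lemma fun_calculusX : is_fun_calculus id T T.
Proof.
split=> // e e0; exists 'X => [t _|x]; first by rewrite hornerX subrr normr0 ltW.
by rewrite poly_opX subrr rnorm0 mulr_ge0 ?rnorm_ge0 ?ltW.
Qed.

Lemma fun_calculusD f g S U : is_fun_calculus f T S -> is_fun_calculus g T U ->
  is_fun_calculus (fun t => f t + g t) T (fun x => S x + U x).
Proof.
move=> [bS fS] [bU gU]; split; first exact: bounded_opD.
move=> e e0; have e20 : 0 < e / 2 by rewrite divr_gt0.
have [p pf pS] := fS _ e20; have [q qg qU] := gU _ e20.
exists (p + q) => [t tT|x].
  have -> : (p + q).[t] - (f t + g t) = (p.[t] - f t) + (q.[t] - g t).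
    by rewrite hornerD; ring.
  apply: le_trans (ler_normD _ _) _; have := pf t tT; have := qg t tT; lra.
rewrite poly_opD opprD addrACA; apply: le_trans (rnormD _ _) _.
have := pS x; have := qU x; lra.
Qed.

Lemma fun_calculusM f g S U : is_fun_calculus f T S -> is_fun_calculus g T U ->
  is_fun_calculus (fun t => f t * g t) T (S \o U).
Proof.
move=> fS gU; split; first exact: bounded_op_comp fS.1 gU.1.
move=> e e0.
have [B B0 fB] := fun_calculus_bounded fS.
have [_ [c c0 Sc]] := (bounded_opP _).1 fS.1.
(* [B + c] dominates both [|f|] on the spectrum and the norm of [S], so one tolerance for [q] serves
   the scalar and the operator estimate. *)
have Bc0 : 0 < B + c by rewrite ltr_pwDl.
have [q qg qU] := gU.2 (e / (2 * (B + c))) (divr_gt0 e0 (mulr_gt0 (ltr0n _ 2) Bc0)).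
have [D D0 qD] := poly_spectrum_bound q.
have [p pf pS] := fS.2 (e / (2 * D)) (divr_gt0 e0 (mulr_gt0 (ltr0n _ 2) D0)).
have -> : e = e / (2 * D) * D + (B + c) * (e / (2 * (B + c))).
  by field; rewrite !gt_eqF.
exists (p * q) => [t tT|x].
  have -> : (p * q).[t] - f t * g t = (p.[t] - f t) * q.[t] + f t * (q.[t] - g t).
    by rewrite hornerM; ring.
  apply: le_trans (ler_normD _ _) _; rewrite !normrM; apply: lerD.
    by apply: ler_pM => //; [exact: pf|exact: qD].
  apply: ler_pM => //; last exact: qg.
  by apply: le_trans (fB t tT) _; rewrite lerDl.
rewrite poly_opM//= -(subrK (S (poly_op q T x)) (poly_op p T _)) -addrA.
rewrite -(linear_opB fS.1.1) mulrDl.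
apply: le_trans (rnormD _ _) _; apply: lerD.
  apply: le_trans (pS _) _; rewrite -[leRHS]mulrA ler_wpM2l//.
    by rewrite divr_ge0 ?(ltW e0)// mulr_ge0// ltW.
  exact: spectral_bound.
apply: le_trans (Sc _) _; rewrite -[leRHS]mulrA.
apply: ler_pM => //; first exact: rnorm_ge0.
by rewrite lerDr ltW.
Qed.

Lemma fun_calculus_poly f S q : is_fun_calculus f T S ->
  is_fun_calculus (fun t => q.[f t]) T (poly_op q S).
Proof.
move=> fS; elim/poly_ind: q => [|q r IH].
  have -> : poly_op 0 S = fun x : H => 0%:C *: x.
    by apply/funext => x; rewrite -polyC0 poly_opC.
  by apply: fun_calculus_ext (fun_calculusC 0) => t _; rewrite horner0.
have -> : poly_op (q * 'X + r%:P) S = fun x => (poly_op q S \o S) x + r%:C *: x.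
  by apply/funext => x; rewrite poly_opD poly_opM ?poly_opX ?poly_opC//; case: fS => -[].
apply: fun_calculus_ext (fun_calculusD (fun_calculusM IH fS) (fun_calculusC r)) => t _.
by rewrite hornerMXaddC.
Qed.

Lemma fun_calculus_selfadjoint f S : is_fun_calculus f T S -> selfadjoint S.
Proof.
move=> [[lS _] fS].
have sS x y : rdot (S x) y = rdot x (S y).
  suff le0 x' y' : rdot (S x') y' - rdot x' (S y') <= 0.
    have := le0 x y; have := le0 y x.
    rewrite [rdot (S y) x]rdotC [rdot y (S x)]rdotC => h1 h2.
    by apply/eqP; rewrite eq_le; apply/andP; split; lra.
  apply: (@le0_of_small_bounds _ (2 * rnorm x' * rnorm y')) => e e0 _.
  have [p _ pS] := fS e e0.
  have h1 := rdot_le (S x' - poly_op p T x') y'.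
  have h2 := rdot_le x' (poly_op p T y' - S y').
  have h3 := ler_wpM2r (rnorm_ge0 y') (pS x').
  have h4 := ler_wpM2l (rnorm_ge0 x') (pS y').
  move: h1 h2; rewrite !rdotE [rnorm (S x' - _)]rnormB.
  have := selfadjoint_rdot x' y' (poly_op_selfadjoint p T_linear T_selfadjoint).
  lra.
move=> x y; apply: dot_rdot; first exact: sS.
by rewrite -(linear_opZ lS) sS.
Qed.

(** If [0 <= f <= B] then [f] is within [B / 2] of the constant [B / 2]. Hence
    [|(B / 2) x - S x| <= (B / 2) |x|], and pairing with [x] gives the sign. *)
Lemma fun_calculus_ge0 f S : is_fun_calculus f T S ->
  (forall t, spectrum T t%:C -> 0 <= f t) -> forall x, 0 <= rdot (S x) x.
Proof.
move=> fS f0 x; have [B B0 fB] := fun_calculus_bounded fS.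
have := @fun_calculus_bound f S (B / 2)%:P (B / 2) fS.
have pB t : spectrum T t%:C -> `|(B / 2)%:P.[t] - f t| <= B / 2.
  move=> tT; have := fB t tT; have := f0 t tT.
  by rewrite hornerC !ler_norml => ft0 /andP[_ ftB]; apply/andP; split; lra.
move=> /(_ pB x); rewrite poly_opC => h.
have := rdot_le ((B / 2)%:C *: x - S x) x.
have := ler_wpM2r (rnorm_ge0 x) h.
rewrite !rdotE rdotxx; lra.
Qed.

Lemma fun_calculus_positive f S : is_fun_calculus f T S ->
  (forall t, spectrum T t%:C -> 0 <= f t) -> positive_op S.
Proof.
move=> fS f0; split; [exact: fS.1|exact: fun_calculus_selfadjoint fS|].
exact: fun_calculus_ge0 fS f0.
Qed.

Lemma fun_calculus_le f g S U : is_fun_calculus f T S -> is_fun_calculus g T U ->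
  (forall t, spectrum T t%:C -> f t <= g t) -> forall x, rdot (S x) x <= rdot (U x) x.
Proof.
move=> fS gU fg x.
have h := fun_calculusD gU (fun_calculusM (fun_calculusC (-1)) fS).
have := fun_calculus_ge0 h _ x.
rewrite /= rdotDl rdotZl => /(_ _); rewrite mulN1r subr_ge0; apply.
by move=> t tT; rewrite mulN1r subr_ge0 fg.
Qed.

Lemma poly_approx_fun_calculus f : (forall M : R, 0 < M -> poly_approx M f) ->
  exists S, is_fun_calculus f T S.
Proof.
move=> fW; apply: fun_calculus_exists => // e e0.
have [M M0 [TM _]] := positive_spectrum.
by have [p pf] := fW M M0 e e0; exists p => t /TM/pf.
Qed.

Lemma op_powP s : 0 <= s -> is_fun_calculus (fun t => t `^ s) T (op_pow T s).
Proof.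
move=> s0.
have [S TS] := poly_approx_fun_calculus (fun M M0 => poly_approx_powR M0 s0).
by rewrite /op_pow (cfcE TS).
Qed.

Lemma op_pow_positive s : 0 <= s -> positive_op (op_pow T s).
Proof.
by move=> s0; apply: fun_calculus_positive (op_powP s0) _ => t _; exact: powR_ge0.
Qed.

End FunctionalCalculus.

(** A polynomial [q] close to [g] on [0, M + B] is close on the spectrum of [S], inside [0, M], and
    at the values of [f], which are at most [B]. So [q(S)] is near [U], and it is also the calculus
    of [q o f] at [T]. *)
Lemma fun_calculus_comp T f g S U : positive_op T ->
  is_fun_calculus f T S -> (forall t, spectrum T t%:C -> 0 <= f t) ->
  (forall M : R, 0 < M -> poly_approx M g) -> is_fun_calculus g S U ->
  is_fun_calculus (fun t => g (f t)) T U.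
Proof.
move=> posT fS f0 gW gU; split; first exact: gU.1.
move=> e e0; have e20 : 0 < e / 2 by rewrite divr_gt0.
have posS := fun_calculus_positive posT fS f0.
have [M M0 [SM _]] := positive_spectrum posS.
have [B B0 fB] := fun_calculus_bounded posT fS.
have [q qg] := gW (M + B) (addr_gt0 M0 B0) _ e20.
have [p pf pS] := (fun_calculus_poly posT q fS).2 _ e20.
exists p => [t tT|x].
  have -> : p.[t] - g (f t) = (p.[t] - q.[f t]) + (q.[f t] - g (f t)) by ring.
  apply: le_trans (ler_normD _ _) _.
  have := pf t tT; have : `|q.[f t] - g (f t)| <= e / 2; last lra.
  apply: qg; rewrite f0//=; apply: le_trans (ler_norm _) _.
  by apply: le_trans (fB t tT) _; rewrite lerDr ltW.
have qU : forall t, spectrum S t%:C -> `|q.[t] - g t| <= e / 2.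
  move=> t /SM /andP[t0 tM]; apply: qg; rewrite t0/=.
  by apply: le_trans tM _; rewrite lerDl ltW.
have := fun_calculus_bound posS gU qU x; have := pS x.
have := rnorm_triangle (poly_op q S x) (poly_op p T x) (U x); lra.
Qed.

Lemma op_pow_pow T s t : positive_op T -> 0 <= s -> 0 <= t ->
  op_pow (op_pow T s) t = op_pow T (s * t).
Proof.
move=> posT s0 t0.
apply: (fun_calculus_unique posT _ (op_powP posT (mulr_ge0 s0 t0))).
apply: (@fun_calculus_ext T (fun u => (u `^ s) `^ t)).
  by move=> u _; rewrite powRrM.
apply: (@fun_calculus_comp T (fun u => u `^ s) (fun u => u `^ t)) => //.
- exact: op_powP.
- by move=> u _; exact: powR_ge0.
- by move=> M M0; exact: poly_approx_powR.
- by apply: op_powP => //; exact: op_pow_positive.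
Qed.

Lemma op_powD T s t : positive_op T -> 0 <= s -> 0 <= t ->
  (forall x, op_pow T (s + t) x = op_pow T s (op_pow T t x)).
Proof.
move=> posT s0 t0 x.
suff -> : op_pow T (s + t) = op_pow T s \o op_pow T t by [].
apply: (fun_calculus_unique posT) (op_powP posT (addr_ge0 s0 t0)) _.
apply: fun_calculus_ext (fun_calculusM posT (op_powP posT s0) (op_powP posT t0)) => u uT.
(* At [u = 0] the law of exponents depends on the convention [0 ^ 0 = 1], whence the case split on
   [s]. *)
have [->|u0] := eqVneq u 0; last by rewrite powRD// u0 implybT.
have [->|sn0] := eqVneq s 0; first by rewrite powRr0 mul1r add0r.
have sp : 0 < s by rewrite lt_def sn0.
have st : s + t != 0 by rewrite gt_eqF// ltr_pwDl.
by rewrite (powR0 sn0) (powR0 st) mul0r.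
Qed.

Lemma op_pow1 T : positive_op T -> op_pow T 1 = T.
Proof.
move=> posT; have [M M0 [TM _]] := positive_spectrum posT.
apply: (fun_calculus_unique posT (op_powP posT ler01)).
apply: fun_calculus_ext (fun_calculusX posT) => t /TM/andP[t0 _].
by rewrite powRr1.
Qed.

(** * Mixed Schwarz and Buzano inequalities *)

Lemma adjoint_sym S U : (forall x y, dot (S x) y = dot x (U y)) ->
  forall x y, dot (U x) y = dot x (S y).
Proof. by move=> SU x y; rewrite dotC -SU -dotC. Qed.

Lemma adjointK T : bounded_op T -> adjoint dot (adjoint dot T) = T.
Proof.
move=> bT; have [bT' hT] := adjointP bT.
have [_ hT'] := adjointP bT'.
apply/funext => y; apply: rdot_eq => z.
by rewrite rdotC [RHS]rdotC /rdot -hT' (adjoint_sym hT).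
Qed.

Lemma positive_op_comp_adjoint S U : bounded_op S -> bounded_op U ->
  (forall x y, dot (S x) y = dot x (U y)) -> positive_op (U \o S).
Proof.
move=> bS bU SU; split.
- exact: bounded_op_comp bU bS.
- by move=> x y /=; rewrite (adjoint_sym SU) SU.
- by move=> x /=; rewrite /rdot (adjoint_sym SU) -/(rdot _ _) rdotxx sqr_ge0.
Qed.

(** For polynomials, [A p(B A) = p(A B) A] by associativity. One [p] close to [f] on [0, M + N],
    which contains both spectra, carries this over to [f]. *)
Lemma fun_calculus_intertwine A B f S U : bounded_op A ->
  positive_op (B \o A) -> positive_op (A \o B) ->
  (forall M : R, 0 < M -> poly_approx M f) ->
  is_fun_calculus f (B \o A) S -> is_fun_calculus f (A \o B) U ->
  forall x, A (S x) = U (A x).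
Proof.
move=> /bounded_opP[lA [c c0 hA]] posP posQ fW fS fU x.
have [M M0 [PM _]] := positive_spectrum posP.
have [N N0 [QN _]] := positive_spectrum posQ.
apply/eqP; rewrite -subr_eq0; apply/eqP/rnorm_eq0/eqP; rewrite eq_le rnorm_ge0 andbT.
apply: (@le0_of_small_bounds _ (2 * c * rnorm x)) => e e0 _.
have [p pf] := fW (M + N) (addr_gt0 M0 N0) e e0.
have pP t : spectrum (B \o A) t%:C -> `|p.[t] - f t| <= e.
  by move=> /PM/andP[t0 tM]; apply: pf; rewrite t0 (le_trans tM)// lerDl ltW.
have pQ t : spectrum (A \o B) t%:C -> `|p.[t] - f t| <= e.
  by move=> /QN/andP[t0 tN]; apply: pf; rewrite t0 (le_trans tN)// lerDr ltW.
have [lP _] := posP; have [lQ _] := posQ.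
have comm q y : A (poly_op q (B \o A) y) = poly_op q (A \o B) (A y).
  elim/poly_ind: q y => [|q r IH] y.
    by rewrite -polyC0 !poly_opC (linear_opZ lA).
  rewrite !poly_opD (poly_opM _ _ _ lP.1) (poly_opM _ _ _ lQ.1) !poly_opX !poly_opC.
  by rewrite (linear_opD lA) (linear_opZ lA) IH.
have h1 := fun_calculus_bound posP fS pP x.
have h2 := fun_calculus_bound posQ fU pQ (A x).
have h3 := hA (poly_op p (B \o A) x - S x).
have h4 := hA x.
have := rnorm_triangle (poly_op p (A \o B) (A x)) (A (S x)) (U (A x)).
rewrite [rnorm (A (S x) - poly_op _ _ _)]rnormB -{1}comm -(linear_opB lA).
have h5 := ler_wpM2l c0 h1; have h6 := ler_wpM2l (ltW e0) h4.
lra.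
Qed.

(** With the square root of [T], [<T x, y> = <T^(1/2) x, T^(1/2) y>], and the usual inequality
    applies. *)
Lemma positive_cauchy_schwarz T x y : positive_op T ->
  complex.Re `|dot (T x) y| ^+ 2 <= rdot (T x) x * rdot (T y) y.
Proof.
move=> posT.
have h0 : 0 <= 2^-1 :> R by rewrite invr_ge0.
have TE z : T z = op_pow T 2^-1 (op_pow T 2^-1 z).
  rewrite -op_powD // -{1}(op_pow1 posT); congr (op_pow T _ z).
  by field.
have [_ sS _] := op_pow_positive posT h0.
have TEn z : rdot (T z) z = rnorm (op_pow T 2^-1 z) ^+ 2.
  by rewrite TE (selfadjoint_rdot _ _ sS) rdotxx.
rewrite !TEn TE sS -exprMn ler_sqr ?nnegrE ?mulr_ge0 ?rnorm_ge0//.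
  exact: dot_le.
exact: Re_norm_ge0.
Qed.

(* With [P = B A], [Q = A B] and [h t = t ^ alpha + e], write
   [<A x, y> = <h(P) x, h(P)^-1 B y>] and use the Cauchy-Schwarz inequality of
   the form [<h(P) _, _>]; then [A h(P)^-1 B = h(Q)^-1 Q <= Q ^ (1 - alpha)]. *)
Lemma mixed_schwarz A B x y alpha : bounded_op A -> bounded_op B ->
  (forall x y, dot (A x) y = dot x (B y)) -> 0 <= alpha <= 1 ->
  complex.Re `|dot (A x) y| ^+ 2 <=
    rdot (op_pow (B \o A) alpha x) x * rdot (op_pow (A \o B) (1 - alpha) y) y.
Proof.
move=> bA bB AB alpha01; have /andP[a0 a1] := alpha01.
have posP := positive_op_comp_adjoint bA bB AB.
have posQ := positive_op_comp_adjoint bB bA (adjoint_sym AB).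
have b0 : 0 <= 1 - alpha by rewrite subr_ge0.
have Qy0 : 0 <= rdot (op_pow (A \o B) (1 - alpha) y) y.
  by case: (op_pow_positive posQ b0).
rewrite -subr_le0.
apply: (@le0_of_small_bounds _ (rnorm x ^+ 2 * rdot (op_pow (A \o B) (1 - alpha) y) y)) => e e0 _.
(* [e > 0] keeps [t ^ alpha + e] away from 0 even if 0 is in the spectrum. Its cost is the term
   [e * rnorm x ^+ 2] in [<S x, x>], which accounts for the constant just given. *)
have kW (M : R) : 0 < M -> poly_approx M (fun t => (t `^ alpha + e)^-1).
  by move=> M0; exact: poly_approx_inv_powR.
have [K PK] := poly_approx_fun_calculus posP kW.
have [L QL] := poly_approx_fun_calculus posQ kW.
have Ph := fun_calculusD (op_powP posP a0) (fun_calculusC (B \o A) e).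
set S := fun z => _ in Ph.
have he t : 0 < t `^ alpha + e by rewrite ltr_wpDl// powR_ge0.
have posS : positive_op S.
  by apply: (fun_calculus_positive posP Ph) => t _; exact/ltW.
have SK z : S (K z) = z.
  have -> : S (K z) = (S \o K) z by [].
  rewrite -[RHS]scale1r; congr ((_ : H -> H) z).
  apply: (fun_calculus_unique posP (fun_calculusM posP Ph PK)).
  apply: fun_calculus_ext (fun_calculusC _ 1) => t _.
  by rewrite divff// gt_eqF.
have sS : selfadjoint S by case: posS.
have xAy : dot (A x) y = dot (S x) (K (B y)) by rewrite AB -{1}[B y]SK sS.
have := positive_cauchy_schwarz x (K (B y)) posS.
rewrite -xAy SK.
(* Moving [B] to the other side leaves [A K B y], and intertwining gives [A K = L A]. *)
have -> : rdot (B y) (K (B y)) = rdot ((L \o (A \o B)) y) y.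
  rewrite /rdot (adjoint_sym AB) (fun_calculus_intertwine bA posP posQ kW PK QL).
  by rewrite -[LHS]/(rdot _ _) rdotC.
have : rdot ((L \o (A \o B)) y) y <= rdot (op_pow (A \o B) (1 - alpha) y) y.
  apply: (fun_calculus_le posQ (fun_calculusM posQ QL (fun_calculusX posQ)) (op_powP posQ b0)).
  have [M M0 [QM _]] := positive_spectrum posQ.
  move=> t /QM/andP[t0 _]; rewrite mulrC ler_pdivrMr//.
  (* The exponents add up to 1, which is nonzero, so the factorisation holds at [t = 0] too; it
     shows [t / (t ^ alpha + e) <= t ^ (1 - alpha)]. *)
  have {1}-> : t = t `^ (1 - alpha) * t `^ alpha.
    rewrite -powRD ?subrK ?powRr1//.
    by rewrite oner_eq0.
  by rewrite ler_wpM2l ?powR_ge0// lerDl ltW.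
have Sx : rdot (S x) x = rdot (op_pow (B \o A) alpha x) x + e * rnorm x ^+ 2.
  by rewrite /S rdotDl rdotZl rdotxx.
have Sx0 : 0 <= rdot (S x) x by case: posS.
move=> h1 h2; have := le_trans h2 (ler_wpM2l Sx0 h1).
rewrite Sx; lra.
Qed.

(** * Numerical radius and Buzano's inequality *)

Lemma norm_eq1 x : (`|x| = 1) <-> (rnorm x = 1).
Proof.
by rewrite rnormE; split=> [/(@complexI R)|->].
Qed.

Lemma numerical_radius_ub T : bounded_op T ->
  has_ubound [set complex.Re `|dot (T x) x| | x in [set x : H | `|x| = 1]].
Proof.
move=> /bounded_opP[_ [c c0 Tc]]; exists c => _ [x /= /norm_eq1 x1 <-].
apply: le_trans (dot_le _ _) _; rewrite x1 mulr1.
by apply: le_trans (Tc x) _; rewrite x1 mulr1.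
Qed.

Lemma le_numerical_radius T x : bounded_op T -> rnorm x = 1 ->
  complex.Re `|dot (T x) x| <= numerical_radius dot T.
Proof.
by move=> bT /norm_eq1 x1; apply: (ub_le_sup (numerical_radius_ub bT)); exists x.
Qed.

(** In the zero space there is no unit vector and the supremum of the empty set is 0, which is why
    [c] is asked to be nonnegative. *)
Lemma numerical_radius_le T c : 0 <= c ->
  (forall x, rnorm x = 1 -> complex.Re `|dot (T x) x| <= c) -> numerical_radius dot T <= c.
Proof.
move=> c0 Tc; rewrite /numerical_radius.
set E := [set _ | _ in _]; have [->|/set0P E0] := eqVneq E set0; first by rewrite sup0.
by apply: ge_sup => // _ [x /= /norm_eq1 x1 <-]; exact: Tc.
Qed.

Lemma numerical_radius_ge0 T : bounded_op T -> 0 <= numerical_radius dot T.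
Proof.
move=> bT; rewrite /numerical_radius.
set E := [set _ | _ in _]; have [->|/set0P[_ [x /= /norm_eq1 x1 _]]] := eqVneq E set0.
  by rewrite sup0.
exact: le_trans (Re_norm_ge0 _) (le_numerical_radius bT x1).
Qed.

(* Buzano: reflecting [a] in the line of [x] preserves its norm. *)
Lemma buzano a b x : rnorm x = 1 ->
  2 * (rdot a x * rdot b x) <= rnorm a * rnorm b + rdot a b.
Proof.
move=> x1; set u := rdot a x.
have h := rdot_le ((2 * u)%:C *: x - a) b.
have e : rnorm ((2 * u)%:C *: x - a) = rnorm a.
  apply/eqP; rewrite -(@eqrXn2 _ 2) ?rnorm_ge0//; apply/eqP.
  rewrite -rdotxx !rdotE !rdotxx x1 [rdot x a]rdotC -/u; ring.
move: h; rewrite e !rdotE [rdot x b]rdotC; lra.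
Qed.

End HilbertSpace.

Theorem theorem2p10 (R : realType) (H : completeNormedModType R[i])
    (dot : {dot H for Num.conj})
    (dot_norm : forall x : H, `|x| ^+ 2 = dot x x)
    (A : H -> H) (A_bounded : bounded_op A)
    (alpha : R) (alpha01 : 0 <= alpha <= 1) :
  numerical_radius dot A ^+ 2 <=
    4^-1 * opnorm (op_pow (op_abs dot A) (4 * alpha)
                   \+ op_pow (op_abs dot (adjoint dot A)) (4 * (1 - alpha)))
    + 2^-1 * numerical_radius dot
               (op_pow (op_abs dot (adjoint dot A)) (2 * (1 - alpha))
                \o op_pow (op_abs dot A) (2 * alpha)).
Proof.
have [bB AB] := adjointP dot_norm A_bounded.
rewrite /op_abs (adjointK dot_norm A_bounded).
set B := adjoint dot A in bB AB *.
have posP := positive_op_comp_adjoint dot_norm A_bounded bB AB.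
have posQ := positive_op_comp_adjoint dot_norm bB A_bounded (adjoint_sym AB).
have /andP[a0 a1] := alpha01; have b0 : 0 <= 1 - alpha by rewrite subr_ge0.
(* Taking the square root halves exponents: [n = 2] handles the exponents with factor 4, [n = 1]
   those with factor 2. *)
have pow_abs (T : H -> H) (n : nat) s : positive_op dot T -> 0 <= s ->
    op_pow (op_pow T 2^-1) (n.*2%:R * s) = op_pow T (n%:R * s).
  move=> posT s0; rewrite (op_pow_pow dot_norm)// ?invr_ge0// ?mulr_ge0//.
  by congr op_pow; rewrite -muln2 natrM; field.
rewrite !(pow_abs _ 2%N)// !(pow_abs _ 1%N)// !mul1r.
set P := B \o A in posP *; set Q := A \o B in posQ *.
have pos2P := op_pow_positive dot_norm posP (mulr_ge0 (ler0n _ 2) a0).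
have pos2Q := op_pow_positive dot_norm posQ (mulr_ge0 (ler0n _ 2) b0).
have posPa := op_pow_positive dot_norm posP a0.
have posQb := op_pow_positive dot_norm posQ b0.
have bsum : bounded_op (op_pow P (2 * alpha) \+ op_pow Q (2 * (1 - alpha))).
  by case: pos2P => + _ _; case: pos2Q => + _ _; move=> ? ?; exact: bounded_opD.
have bcomp : bounded_op (op_pow Q (1 - alpha) \o op_pow P alpha).
  by case: posPa => + _ _; case: posQb => + _ _; exact: bounded_op_comp.
set N := opnorm _; set w := numerical_radius dot (_ \o _).
have N0 : 0 <= N by exact: opnorm_ge0.
have w0 : 0 <= w by exact: numerical_radius_ge0.
have C0 : 0 <= 4^-1 * N + 2^-1 * w by rewrite addr_ge0// mulr_ge0// invr_ge0.
(* The right-hand side is written as the square of its root, so that the supremum can be bounded one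
   unit vector at a time. *)
rewrite -[leRHS]sqr_sqrtr// ler_sqr ?nnegrE ?sqrtr_ge0//; last first.
  exact: numerical_radius_ge0.
apply: numerical_radius_le; first exact: sqrtr_ge0.
move=> x x1; rewrite -ler_sqr ?nnegrE ?sqrtr_ge0 ?Re_norm_ge0// sqr_sqrtr//.
apply: le_trans (mixed_schwarz dot_norm x x A_bounded bB AB alpha01) _.
rewrite -/P -/Q; set a := op_pow P alpha x; set b := op_pow Q (1 - alpha) x.
(* The real form is enough: [rdot a x] and [rdot b x] are exactly the two factors from the mixed
   Schwarz inequality. *)
have := buzano dot_norm a b x1.
have sq (T : H -> H) s : positive_op dot T -> 0 <= s ->
    rnorm (op_pow T s x) ^+ 2 = rdot dot (op_pow T (2 * s) x) x.
  move=> posT s0; rewrite mulr_natl mulr2n (op_powD dot_norm)//.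
  have [_ sS _] := op_pow_positive dot_norm posT s0.
  by rewrite (selfadjoint_rdot _ _ sS) (rdotxx dot_norm).
(* Self-adjointness of [Q ^ (1 - alpha)] turns [<a, b>] into the quadratic form of the composite in
   [w], in the stated order. *)
have ab : rdot dot a b <= w.
  have [_ sQ _] := posQb.
  rewrite /a /b -(selfadjoint_rdot _ _ sQ).
  exact: le_trans (Re_le_norm _) (le_numerical_radius dot_norm bcomp x1).
have : rnorm a ^+ 2 + rnorm b ^+ 2 <= N.
  rewrite !sq// -rdotDl; apply: le_trans (rdot_le dot_norm _ _) _.
  by rewrite x1 mulr1; have := rnorm_le_opnorm x bsum; rewrite x1 mulr1.
have := sqr_ge0 (rnorm a - rnorm b).
nra.
Qed.
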